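(* Let $\mathfrak g$ be a finitely generated Lie algebra over $\mathbb Z$ and let $\mathfrak f\twoheadrightarrow\mathfrak g$ be a surjective homomorphism (a presentation), where $\mathfrak f$ is a free Lie algebra over $\mathbb Z$ of finite rank. Then the cokernel of the map $$H_2(\widehat{\mathfrak f})\oplus H_2(\mathfrak g)\longrightarrow H_2(\widehat{\mathfrak g})$$ induced by $\widehat{\mathfrak f}\to\widehat{\mathfrak g}$ and the canonical homomorphism $\mathfrak g\to\widehat{\mathfrak g}$ is a cotorsion group.
   Context: All Lie algebras are over $\mathbb Z$. For a Lie algebra $\mathfrak g$, the lower central series is $\gamma_1(\mathfrak g)=\mathfrak g$, $\gamma_{i+1}(\mathfrak g)=[\gamma_i(\mathfrak g),\mathfrak g]$, and the pronilpotent completion is $\widehat{\mathfrak g}=\varprojlim_i\mathfrak g/\gamma_i(\mathfrak g)$. Homology is $H_n(\mathfrak g)=\mathrm{Tor}_n^{U\mathfrak g}(\mathbb Z,\mathbb Z)$, where $U\mathfrak g$ is the universal enveloping algebra. An abelian group $A$ is called cotorsion if $\mathrm{Ext}^1_{\mathbb Z}(\mathbb Q,A)=0$. *)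

(* Defs.v *)
From HB Require Import structures.
From mathcomp Require Import all_boot all_order all_algebra.
From mathcomp Require Import finmap.
From mathcomp Require Import boolp classical_sets functions.
From mathcomp Require Import monalg.

Set Implicit Arguments.
Unset Strict Implicit.
Unset Printing Implicit Defensive.

Import GRing.Theory.

Local Open Scope ring_scope.
Local Open Scope quotient_scope.

Local Notation "{ 'quot' I }" := (@Quotient.quot _ I) : type_scope.

Section Span.
Variables (V : zmodType) (S : set V).

Inductive zspan : set V :=
| zspan_gen x : S x -> zspan x
| zspan_zero : zspan 0
| zspan_sub x y : zspan x -> zspan y -> zspan (x - y).

Definition zspan_pred : {pred V} := [pred x | `[< zspan x >]].

Lemma zspan_predP x : reflect (zspan x) (x \in zspan_pred).
Proof. exact: asboolP. Qed.

Lemma zspan_closed : zmod_closed zspan_pred.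
Proof.
split; first by apply/zspan_predP; exact: zspan_zero.
by move=> x y /zspan_predP hx /zspan_predP hy; apply/zspan_predP; exact: zspan_sub.
Qed.

HB.instance Definition _ := GRing.isZmodClosed.Build V zspan_pred zspan_closed.

Lemma zspan_min (P : zmodClosed V) :
  (forall x, S x -> x \in P) -> forall x, zspan x -> x \in P.
Proof.
by move=> SP x; elim=> [{}x /SP//| |y z _ hy _ hz]; [exact: rpred0|exact: rpredB].
Qed.

End Span.

Lemma zspan_map (V W : zmodType) (f : {additive V -> W}) (S : set V) (T : set W) :
  (forall x, S x -> zspan T (f x)) -> forall x, zspan S x -> zspan T (f x).
Proof.
move=> h x; elim=> [{}x /h//| |y z _ hy _ hz].
  by rewrite raddf0; exact: zspan_zero.
by rewrite raddfB; exact: zspan_sub.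
Qed.

Section QuotMap.
Variables (V W : zmodType) (I : zmodClosed V) (J : zmodClosed W).
Variables (f : {additive V -> W}).

Definition quot_map (x : {quot I}) : {quot J} := \pi_{quot J} (f (repr x)).

Hypothesis fIJ : forall x, x \in I -> f x \in J.

Lemma quot_map_pi x : quot_map (\pi_{quot I} x) = \pi_{quot J} (f x).
Proof.
apply/eqP; rewrite -Quotient.idealrBE -raddfB; apply: fIJ.
by rewrite Quotient.idealrBE reprK.
Qed.

Lemma quot_map_additive : zmod_morphism quot_map.
Proof.
move=> x y; rewrite -[x]reprK -[y]reprK -raddfB !quot_map_pi.
by rewrite raddfB /= raddfB.
Qed.

End QuotMap.

Arguments quot_map {V W} I J f x.

(** Homology at [B] of [A --f--> B --g--> C]. *)
Section Homology.
Variables (A B C : zmodType) (f : {additive A -> B}) (g : {additive B -> C}).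

Definition zker_pred : {pred B} := [pred x | g x == 0].

Lemma zker_closed : zmod_closed zker_pred.
Proof.
split; first by rewrite inE raddf0.
by move=> x y; rewrite !inE raddfB => /eqP-> /eqP->; rewrite subr0.
Qed.

HB.instance Definition _ := GRing.isZmodClosed.Build B zker_pred zker_closed.

Definition zker : Type := {x : B | x \in zker_pred}.

HB.instance Definition _ := SubChoice.on zker.
HB.instance Definition _ := [SubChoice_isSubZmodule of zker by <:].

Definition im_pred : {pred zker} := [pred x | `[< exists a, f a = val x >]].

Lemma im_closed : zmod_closed im_pred.
Proof.
split; first by apply/asboolP; exists 0; rewrite !raddf0.
move=> x y /asboolP[a ha] /asboolP[b hb]; apply/asboolP; exists (a - b).
by rewrite !raddfB /= ha hb.
Qed.

HB.instance Definition _ := GRing.isZmodClosed.Build zker im_pred im_closed.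

Definition homol : zmodType := {quot im_pred}.

End Homology.

Arguments im_pred {A B C} f g.

Section HomologyMap.
Variables (A B C : zmodType) (f : {additive A -> B}) (g : {additive B -> C}).
Variables (A' B' C' : zmodType).
Variables (f' : {additive A' -> B'}) (g' : {additive B' -> C'}).
Variables (a : {additive A -> A'}) (b : {additive B -> B'}) (c : {additive C -> C'}).
Hypotheses (bf : forall x, b (f x) = f' (a x)) (cg : forall x, c (g x) = g' (b x)).

Lemma zker_map_subproof (x : zker g) : b (val x) \in zker_pred g'.
Proof. by rewrite inE -cg (eqP (valP x)) raddf0. Qed.

Definition zker_map (x : zker g) : zker g' := Sub (b (val x)) (zker_map_subproof x).

Lemma zker_map_additive : zmod_morphism zker_map.
Proof. by move=> x y; apply: val_inj; rewrite /= !raddfB. Qed.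

HB.instance Definition _ :=
  GRing.isZmodMorphism.Build (zker g) (zker g') zker_map zker_map_additive.

Lemma zker_map_im x : x \in im_pred f g -> zker_map x \in im_pred f' g'.
Proof. by case/asboolP=> y hy; apply/asboolP; exists (a y); rewrite -bf hy. Qed.

Definition homol_map : {additive homol f g -> homol f' g'} :=
  HB.pack_for {additive homol f g -> homol f' g'}
    (quot_map (im_pred f g) (im_pred f' g') zker_map)
    (GRing.isZmodMorphism.Build _ _ _ (quot_map_additive zker_map_im)).

End HomologyMap.

Section Coker.
Variables (A B : zmodType) (f : {additive A -> B}).

Definition range_pred : {pred B} := [pred x | `[< exists a, f a = x >]].

Lemma range_closed : zmod_closed range_pred.
Proof.
split; first by apply/asboolP; exists 0; rewrite raddf0.
move=> _ _ /asboolP[a <-] /asboolP[b <-]; apply/asboolP; exists (a - b).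
by rewrite raddfB.
Qed.

HB.instance Definition _ := GRing.isZmodClosed.Build B range_pred range_closed.

Definition coker : zmodType := {quot range_pred}.

End Coker.

Section CoPair.
Variables (A B C : zmodType) (f : {additive A -> C}) (g : {additive B -> C}).

Definition copair (x : A * B) : C := f x.1 + g x.2.

Lemma copair_additive : zmod_morphism copair.
Proof. by move=> x y; rewrite /copair !raddfB opprD addrACA. Qed.

HB.instance Definition _ :=
  GRing.isZmodMorphism.Build (A * B)%type C copair copair_additive.

End CoPair.

(** [lext rho h] is the [rho]-semilinear extension of [h : X -> M] to the free
    module [{malg R[X]}]. *)
Section SemilinearExtension.
Variables (R S : nzRingType) (rho : {rmorphism R -> S}).
Variables (X : choiceType) (M : lmodType S) (h : X -> M).

Definition lext (u : {malg R[X]}) : M := \sum_(k <- msupp u) rho u@_k *: h k.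

Lemma lextEw (d : {fset X}) u : (msupp u `<=` d)%fset ->
  lext u = \sum_(k <- d) rho u@_k *: h k.
Proof.
move=> le; rewrite [LHS](big_fset_incl _ le) => //= x xd /mcoeff_outdom ->.
by rewrite raddf0 scale0r.
Qed.

Lemma lext_additive : zmod_morphism lext.
Proof.
move=> u v; pose d := (msupp u `|` msupp v)%fset.
rewrite !(lextEw (d := d)) ?fsubsetUl ?fsubsetUr ?msuppB_le //.
by rewrite -sumrB; apply: eq_bigr => k _; rewrite mcoeffB rmorphB scalerBl.
Qed.

Lemma lext_scalable : scalable_for (rho \; *:%R) lext.
Proof.
move=> r u; rewrite (lextEw (msuppZ_le r u)) /lext /= scaler_sumr.
by apply: eq_bigr => k _; rewrite mcoeffZ rmorphM scalerA.
Qed.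

Lemma lextU r x : lext << r *g x >> = rho r *: h x.
Proof. by rewrite (lextEw msuppU_le) big_seq_fset1 mcoeffUU. Qed.

HB.instance Definition _ :=
  GRing.isZmodMorphism.Build {malg R[X]} M lext lext_additive.
HB.instance Definition _ :=
  GRing.isScalable.Build R {malg R[X]} M (rho \; *:%R) lext lext_scalable.

End SemilinearExtension.

Section LinearExtension.
Variables (R : nzRingType) (X : choiceType) (M : lmodType R) (h : X -> M).

Definition linext : {malg R[X]} -> M := lext idfun h.

HB.instance Definition _ :=
  GRing.isZmodMorphism.Build {malg R[X]} M linext (lext_additive idfun h).
HB.instance Definition _ :=
  GRing.isScalable.Build R {malg R[X]} M *:%R linext (lext_scalable idfun h).

Lemma linextU r x : linext << r *g x >> = r *: h x.
Proof. exact: lextU. Qed.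

End LinearExtension.

Section LinearKernel.
Variables (R : nzRingType) (U V : lmodType R) (d : {linear U -> V}).

Definition modker_pred : {pred U} := [pred x | d x == 0].

Lemma modker_closed : submod_closed modker_pred.
Proof.
split; first by rewrite inE raddf0.
by move=> r x y; rewrite !inE linearP => /eqP-> /eqP->; rewrite scaler0 addr0.
Qed.

HB.instance Definition _ := GRing.isSubmodClosed.Build R U modker_pred modker_closed.

Definition modker : Type := {x : U | x \in modker_pred}.

HB.instance Definition _ := SubChoice.on modker.
HB.instance Definition _ := [SubChoice_isSubLmodule of modker by <:].

End LinearKernel.

(** The standard free resolution of a module [N],
      ... --> F_2 --> F_1 --> F_0 --> N --> 0,
    where [F_0] is free on the underlying set of [N], and [F_(n+1)] is free on
    the underlying set of the kernel of the map out of [F_n].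
    [resol N n] is the arrow out of [F_n]. *)
Section Resolution.
Variable R : nzRingType.

Record arrow := Arrow {
  src : lmodType R; tgt : lmodType R; diff : {linear src -> tgt} }.

Definition next_arrow (s : arrow) : arrow :=
  Arrow (linext (fun k : modker (diff s) => val k)).

Fixpoint resol (N : lmodType R) (n : nat) : arrow :=
  if n is m.+1 then next_arrow (resol N m) else Arrow (linext (@id N)).

End Resolution.

Section ResolutionMap.
Variables (R S : nzRingType) (rho : {rmorphism R -> S}).

Record arrow_map (s : arrow R) (t : arrow S) := ArrowMap {
  map_src : {linear src s -> src t | rho \; *:%R};
  map_tgt : {linear tgt s -> tgt t | rho \; *:%R};
  map_diff : forall x, map_tgt (diff s x) = diff t (map_src x) }.

Section Next.
Variables (s : arrow R) (t : arrow S) (m : arrow_map s t).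

Lemma modker_map_subproof (x : modker (diff s)) :
  map_src m (val x) \in modker_pred (diff t).
Proof. by rewrite inE -map_diff (eqP (valP x)) raddf0. Qed.

Definition modker_map (x : modker (diff s)) : modker (diff t) :=
  Sub (map_src m (val x)) (modker_map_subproof x).

Lemma next_map_diff (u : src (next_arrow s)) :
  map_src m (diff (next_arrow s) u) =
  diff (next_arrow t) (lext rho (fun x => << modker_map x >>) u).
Proof.
rewrite /= /linext {1 3}/lext !raddf_sum; apply: eq_bigr => k _ /=.
by rewrite linearZ /= linearZ /= -/(linext _ _) linextU scale1r.
Qed.

Definition next_map : arrow_map (next_arrow s) (next_arrow t) :=
  @ArrowMap (next_arrow s) (next_arrow t) (lext rho (fun x => << modker_map x >>))
    (map_src m) next_map_diff.

End Next.

Variables (N : lmodType R) (N' : lmodType S).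
Variable f : {linear N -> N' | rho \; *:%R}.

Lemma resol_map0_diff (u : src (resol N 0)) :
  f (diff (resol N 0) u) = diff (resol N' 0) (lext rho (fun x => << f x >>) u).
Proof.
rewrite /= /linext {1 3}/lext !raddf_sum; apply: eq_bigr => k _ /=.
by rewrite linearZ /= linearZ /= -/(linext _ _) linextU scale1r.
Qed.

Fixpoint resol_map (n : nat) : arrow_map (resol N n) (resol N' n) :=
  if n is m.+1 then next_map (resol_map m)
  else @ArrowMap (resol N 0) (resol N' 0) (lext rho (fun x => << f x >>)) f
         resol_map0_diff.

End ResolutionMap.

(** Right [R]-modules are left modules over the converse ring [R^c]:
    for [m : M], the product of [m] by [r] on the right is
    [(r : R^c) *: m]. *)
Section Tensor.
Variables (R : nzRingType) (M : lmodType R^c) (N : lmodType R).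

Definition tensor_free : lmodType int := {malg int[(M * N)%type]}.
Definition tgen (m : M) (n : N) : tensor_free := << (m, n) >>.

Inductive tensor_rel : set tensor_free :=
| tensor_addl m m' n : tensor_rel (tgen (m + m') n - tgen m n - tgen m' n)
| tensor_addr m n n' : tensor_rel (tgen m (n + n') - tgen m n - tgen m n')
| tensor_bal (r : R) m n :
    tensor_rel (tgen ((r : R^c) *: m) n - tgen m (r *: n)).

Definition tensor : zmodType := {quot zspan_pred tensor_rel}.

Lemma tensor_free_ext (A : zmodType) (f g : {additive tensor_free -> A}) :
  (forall m n, f (tgen m n) = g (tgen m n)) -> f =1 g.
Proof.
move=> fg u; rewrite [u]monalgE !raddf_sum; apply: eq_bigr => -[m n] _.
suff -> : << u@_(m, n) *g (m, n) >> = tgen m n *~ u@_(m, n).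
  by rewrite !raddfMz fg.
by rewrite /tgen -raddfMz /= intz.
Qed.

End Tensor.

Section TensorMap.
Variables (R S : nzRingType) (rho : R -> S).
Variables (M : lmodType R^c) (N : lmodType R).
Variables (M' : lmodType S^c) (N' : lmodType S).
Variables (a : {additive M -> M'}) (f : {additive N -> N'}).
Hypothesis aZ : forall (r : R) m, a ((r : R^c) *: m) = (rho r : S^c) *: a m.
Hypothesis fZ : forall (r : R) n, f (r *: n) = rho r *: f n.

Definition tensor_free_map : {additive tensor_free M N -> tensor_free M' N'} :=
  linext (fun p : (M * N)%type => tgen (a p.1) (f p.2)).

Lemma tensor_free_mapU m n : tensor_free_map (tgen m n) = tgen (a m) (f n).
Proof. by rewrite [LHS]linextU scale1r. Qed.

Lemma tensor_free_map_rel x :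
  x \in zspan_pred (@tensor_rel R M N) ->
  tensor_free_map x \in zspan_pred (@tensor_rel S M' N').
Proof.
move=> /zspan_predP hx; apply/zspan_predP.
move: hx; apply: zspan_map => {}x hx; apply: zspan_gen; case: hx => >.
- rewrite !raddfB !tensor_free_mapU raddfD; exact: tensor_addl.
- rewrite !raddfB !tensor_free_mapU raddfD; exact: tensor_addr.
- rewrite !raddfB !tensor_free_mapU aZ fZ; exact: tensor_bal.
Qed.

Definition tensor_map : {additive tensor M N -> tensor M' N'} :=
  HB.pack_for {additive tensor M N -> tensor M' N'}
    (quot_map (zspan_pred (@tensor_rel R M N)) (zspan_pred (@tensor_rel S M' N'))
       tensor_free_map)
    (GRing.isZmodMorphism.Build _ _ _ (quot_map_additive tensor_free_map_rel)).

Lemma tensor_map_pi u :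
  tensor_map (\pi u) = \pi_(tensor M' N') (tensor_free_map u).
Proof. exact: (quot_map_pi tensor_free_map_rel). Qed.

End TensorMap.

Section Tor.
Variables (R : nzRingType) (M : lmodType R^c) (N : lmodType R).

Definition tensor_diff (s : arrow R) :
    {additive tensor M (src s) -> tensor M (tgt s)} :=
  tensor_map (rho := id) (a := idfun) (f := diff s)
    (fun _ _ => erefl) (linearZ_LR (diff s)).

(** The boundary [M (x) F_n -> M (x) F_(n-1)] (the augmentation being
    replaced by [0] when [n = 0]). *)
Definition tor_diff (n : nat) :
    {additive tensor M (src (resol N n)) -> tensor M (tgt (resol N n))} :=
  if n is 0 then \0 else tensor_diff (resol N n).

Definition Tor (n : nat) : zmodType :=
  @homol (tensor M (src (resol N n.+1))) (tensor M (src (resol N n))) _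
    (tensor_diff (resol N n.+1)) (tor_diff n).

End Tor.

Section TorMap.
Variables (R S : nzRingType) (rho : {rmorphism R -> S}).
Variables (M : lmodType R^c) (N : lmodType R).
Variables (M' : lmodType S^c) (N' : lmodType S).
Variables (a : {additive M -> M'}) (f : {linear N -> N' | rho \; *:%R}).
Hypothesis aZ : forall (r : R) m, a ((r : R^c) *: m) = (rho r : S^c) *: a m.

Section Arrow.
Variables (s : arrow R) (t : arrow S) (m : arrow_map rho s t).

Definition tensor_map_src : {additive tensor M (src s) -> tensor M' (src t)} :=
  tensor_map aZ (linearZ_LR (map_src m)).
Definition tensor_map_tgt : {additive tensor M (tgt s) -> tensor M' (tgt t)} :=
  tensor_map aZ (linearZ_LR (map_tgt m)).

Lemma tensor_diff_map x :
  tensor_map_tgt (tensor_diff M s x) = tensor_diff M' t (tensor_map_src x).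
Proof.
rewrite -[x]reprK; move: (repr x) => u.
rewrite !tensor_map_pi; congr (\pi _).
have := @tensor_free_ext R M (src s) _
  (tensor_free_map a (map_tgt m) \o tensor_free_map idfun (diff s))
  (tensor_free_map idfun (diff t) \o tensor_free_map a (map_src m)).
apply=> p q; transitivity (tgen (a p) (map_tgt m (diff s q))).
  exact: etrans (congr1 _ (tensor_free_mapU _ _ _ _)) (tensor_free_mapU _ _ _ _).
rewrite map_diff; apply/esym.
exact: etrans (congr1 _ (tensor_free_mapU _ _ _ _)) (tensor_free_mapU _ _ _ _).
Qed.

End Arrow.

Lemma tor_diff_map n x :
  tensor_map_tgt (resol_map f n) (tor_diff M N n x) =
  tor_diff M' N' n (tensor_map_src (resol_map f n) x).
Proof. by case: n x => [|n] x; [exact: raddf0|exact: tensor_diff_map]. Qed.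

Definition Tor_map (n : nat) : {additive Tor M N n -> Tor M' N' n} :=
  homol_map (tensor_diff_map (resol_map f n.+1)) (tor_diff_map (n := n)).

End TorMap.

Section Ext.
Variable R : nzRingType.

Section Hom.
Variables U V : lmodType R.

Definition hom_pred : {pred U -> V} := [pred f | `[< linear f >]].

Lemma hom_closed : zmod_closed hom_pred.
Proof.
split; first by apply/asboolP => r x y; rewrite scaler0 addr0.
move=> f g /asboolP hf /asboolP hg; apply/asboolP => r x y.
change (f (r *: x + y) - g (r *: x + y) = r *: (f x - g x) + (f y - g y)).
by rewrite hf hg scalerBr opprD addrACA.
Qed.

HB.instance Definition _ := GRing.isZmodClosed.Build (U -> V) hom_pred hom_closed.

Definition hom : Type := {f : U -> V | f \in hom_pred}.

HB.instance Definition _ := SubChoice.on hom.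
HB.instance Definition _ := [SubChoice_isSubZmodule of hom by <:].

End Hom.

Section Precomp.
Variables (U U' V : lmodType R) (d : {linear U -> U'}).

Lemma precomp_subproof (f : hom U' V) : val f \o d \in @hom_pred U V.
Proof.
by have /asboolP hf := valP f; apply/asboolP => r x y /=; rewrite linearP hf.
Qed.

Definition precomp (f : hom U' V) : hom U V := Sub (val f \o d) (precomp_subproof f).

Lemma precomp_additive : zmod_morphism precomp.
Proof. by move=> f g; apply: val_inj. Qed.

HB.instance Definition _ :=
  GRing.isZmodMorphism.Build (hom U' V) (hom U V) precomp precomp_additive.

End Precomp.

Variables N A : lmodType R.

Definition ext_diff (n : nat) :
    {additive hom (tgt (resol N n)) A -> hom (src (resol N n)) A} :=
  if n is 0 then \0 else precomp (diff (resol N n)).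

Definition Ext (n : nat) : zmodType :=
  @homol _ (hom (src (resol N n)) A) (hom (src (resol N n.+1)) A)
    (ext_diff n) (precomp (diff (resol N n.+1))).

End Ext.

(** [zmodule A] is the abelian group [A] viewed as an [int]-module. *)
Definition cotorsion (A : zmodType) : Prop :=
  forall x : Ext (zmodule rat) (zmodule A) 1, x = 0.

HB.mixin Record Zmodule_isLie L of GRing.Zmodule L := {
  bracket : L -> L -> L;
  bracketDl : forall x y z, bracket (x + y) z = bracket x z + bracket y z;
  bracketDr : forall x y z, bracket x (y + z) = bracket x y + bracket x z;
  bracketxx : forall x, bracket x x = 0;
  jacobi : forall x y z,
    bracket x (bracket y z) + bracket y (bracket z x) + bracket z (bracket x y) = 0
}.

#[short(type="lieAlgType")]
HB.structure Definition LieAlgebra := {L of Zmodule_isLie L & GRing.Zmodule L}.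

HB.mixin Record isLieMorphism (g h : lieAlgType) (f : g -> h) := {
  lie_morph : forall x y, f (bracket x y) = bracket (f x) (f y)
}.

#[short(type="lieMorphType")]
HB.structure Definition LieMorphism (g h : lieAlgType) :=
  {f of isLieMorphism g h f & @GRing.isZmodMorphism g h f}.

Notation "{ 'lie' g -> h }" := (lieMorphType g h)
  (at level 0, g at level 98, h at level 99, format "{ 'lie'  g  ->  h }").

Section LieTheory.
Variable g : lieAlgType.
Implicit Types x y z : g.

Lemma bracketBl x y z : bracket (x - y) z = bracket x z - bracket y z.
Proof. by apply: (addIr (bracket y z)); rewrite -bracketDl !subrK. Qed.

Lemma bracketBr x y z : bracket x (y - z) = bracket x y - bracket x z.
Proof. by apply: (addIr (bracket x z)); rewrite -bracketDr !subrK. Qed.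

Lemma bracket0l x : bracket 0 x = 0.
Proof. by rewrite -{1}(subrr x) bracketBl subrr. Qed.

Lemma bracketC x y : bracket x y = - bracket y x.
Proof.
apply/eqP; rewrite -addr_eq0; apply/eqP.
by rewrite -(bracketxx (x + y)) bracketDl !bracketDr !bracketxx add0r addr0.
Qed.

(** [lcs n] is the term gamma_(n+1) of the lower central series. *)
Fixpoint lcs (n : nat) : set g :=
  if n is m.+1 then
    zspan (fun z => exists x y, lcs m x /\ z = bracket x y)
  else setT.

Definition lcs_pred n : {pred g} := [pred x | `[< lcs n x >]].

Lemma lcs_predP n x : reflect (lcs n x) (x \in lcs_pred n).
Proof. exact: asboolP. Qed.

Lemma lcs_closed n : zmod_closed (lcs_pred n).
Proof.
case: n => [|n]; first by split=> [|x y _ _]; exact/(@lcs_predP 0).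
exact: zspan_closed.
Qed.

HB.instance Definition _ n := GRing.isZmodClosed.Build g (lcs_pred n) (lcs_closed n).

Lemma lcs_bracketl n x y : x \in lcs_pred n -> bracket x y \in lcs_pred n.
Proof.
elim: n x y => [|n IH] x y; first by move=> _; exact/(lcs_predP 0).
move=> /lcs_predP hx; apply/lcs_predP; elim: hx => [{}x hx| |u v _ hu _ hv].
- case: hx => u [v [hu ->]]; apply: zspan_gen; exists (bracket u v), y; split=> //.
  by apply/lcs_predP; apply: IH; apply/lcs_predP.
- by rewrite bracket0l; exact: zspan_zero.
- by rewrite bracketBl; exact: zspan_sub.
Qed.

Lemma lcs_bracketr n x y : y \in lcs_pred n -> bracket x y \in lcs_pred n.
Proof. by move=> hy; rewrite bracketC rpredN; exact: lcs_bracketl. Qed.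

Lemma lcsS n x : x \in lcs_pred n.+1 -> x \in lcs_pred n.
Proof.
move/lcs_predP; elim=> [{}x [u [v [hu ->]]]| |u v _ hu _ hv].
- by apply: lcs_bracketl; apply/lcs_predP.
- exact: rpred0.
- exact: rpredB.
Qed.

Definition lie_generated (S : set g) : Prop :=
  forall P : set g,
    (forall x, S x -> P x) ->
    P 0 -> (forall x y, P x -> P y -> P (x - y)) ->
    (forall x y, P x -> P y -> P (bracket x y)) ->
    forall x, P x.

Definition lie_fg : Prop :=
  exists s : seq g, lie_generated (fun x => x \in s).

Definition lie_free (X : Type) (b : X -> g) : Prop :=
  forall (h : lieAlgType) (y : X -> h), exists phi : {lie g -> h},
    (forall i, phi (b i) = y i) /\
    (forall psi : {lie g -> h}, (forall i, psi (b i) = y i) -> psi =1 phi).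

End LieTheory.

Arguments lcs_pred g n : clear implicits.

Lemma lcs_morph (g h : lieAlgType) (f : {lie g -> h}) n x :
  x \in lcs_pred g n -> f x \in lcs_pred h n.
Proof.
elim: n x => [|n IH] x; first by move=> _; exact/(lcs_predP 0).
move=> /lcs_predP hx; apply/lcs_predP; move: x hx; apply: zspan_map.
move=> _ [x [y [hx ->]]]; apply: zspan_gen; exists (f x), (f y).
by split; [apply/lcs_predP/IH/lcs_predP|exact: lie_morph].
Qed.

Section LcsQuotient.
Variables (g : lieAlgType) (n : nat).

Definition lcs_quot : Type := {quot lcs_pred g n}.
HB.instance Definition _ := GRing.Zmodule.on lcs_quot.

Definition lcs_pi (x : g) : lcs_quot := \pi_{quot lcs_pred g n} x.
Definition lcs_repr (x : lcs_quot) : g := repr (x : {quot lcs_pred g n}).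

Lemma lcs_reprK x : lcs_pi (lcs_repr x) = x.
Proof. exact: (@reprK _ {quot lcs_pred g n}). Qed.

Lemma lcs_pi_eq x y : lcs_pi x = lcs_pi y <-> x - y \in lcs_pred g n.
Proof. by rewrite Quotient.idealrBE; split=> /eqP. Qed.

Lemma lcs_pi_additive : zmod_morphism lcs_pi.
Proof. by move=> x y; rewrite /lcs_pi raddfB. Qed.

HB.instance Definition _ := GRing.isZmodMorphism.Build g lcs_quot lcs_pi lcs_pi_additive.

Definition lcs_bracket (x y : lcs_quot) : lcs_quot :=
  lcs_pi (bracket (lcs_repr x) (lcs_repr y)).

Lemma lcs_bracket_pi x y : lcs_bracket (lcs_pi x) (lcs_pi y) = lcs_pi (bracket x y).
Proof.
rewrite /lcs_bracket; set x' := lcs_repr _; set y' := lcs_repr _; apply/lcs_pi_eq.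
have hx : x' - x \in lcs_pred g n by apply/lcs_pi_eq; rewrite lcs_reprK.
have hy : y' - y \in lcs_pred g n by apply/lcs_pi_eq; rewrite lcs_reprK.
have -> : bracket x' y' - bracket x y = bracket (x' - x) y' + bracket x (y' - y).
  by rewrite bracketBl bracketBr addrA subrK.
by apply: rpredD; [exact: lcs_bracketl|exact: lcs_bracketr].
Qed.

Fact lcs_bracketDl x y z :
  lcs_bracket (x + y) z = lcs_bracket x z + lcs_bracket y z.
Proof.
rewrite -[x]lcs_reprK -[y]lcs_reprK -[z]lcs_reprK -raddfD !lcs_bracket_pi.
by rewrite bracketDl raddfD.
Qed.

Fact lcs_bracketDr x y z :
  lcs_bracket x (y + z) = lcs_bracket x y + lcs_bracket x z.
Proof.
rewrite -[x]lcs_reprK -[y]lcs_reprK -[z]lcs_reprK -raddfD !lcs_bracket_pi.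
by rewrite bracketDr raddfD.
Qed.

Fact lcs_bracketxx x : lcs_bracket x x = 0.
Proof. by rewrite -[x]lcs_reprK lcs_bracket_pi bracketxx raddf0. Qed.

Fact lcs_jacobi x y z :
  lcs_bracket x (lcs_bracket y z) + lcs_bracket y (lcs_bracket z x)
  + lcs_bracket z (lcs_bracket x y) = 0.
Proof.
rewrite -[x]lcs_reprK -[y]lcs_reprK -[z]lcs_reprK !lcs_bracket_pi -!raddfD.
by rewrite /= jacobi raddf0.
Qed.

HB.instance Definition _ := Zmodule_isLie.Build lcs_quot
  lcs_bracketDl lcs_bracketDr lcs_bracketxx lcs_jacobi.

End LcsQuotient.

Section LcsTransition.
Variables (g : lieAlgType) (n : nat).

Definition lcs_trans (x : lcs_quot g n.+1) : lcs_quot g n := lcs_pi n (lcs_repr x).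

Lemma lcs_trans_pi x : lcs_trans (lcs_pi n.+1 x) = lcs_pi n x.
Proof. by apply/lcs_pi_eq/lcsS/lcs_pi_eq; rewrite lcs_reprK. Qed.

Lemma lcs_trans_additive : zmod_morphism lcs_trans.
Proof.
move=> x y; rewrite -[x]lcs_reprK -[y]lcs_reprK -raddfB !lcs_trans_pi.
exact: raddfB.
Qed.

HB.instance Definition _ := GRing.isZmodMorphism.Build _ _ lcs_trans lcs_trans_additive.

Lemma lcs_trans_bracket x y :
  lcs_trans (bracket x y) = bracket (lcs_trans x) (lcs_trans y).
Proof.
rewrite -[x]lcs_reprK -[y]lcs_reprK [X in lcs_trans X]lcs_bracket_pi !lcs_trans_pi.
by rewrite [RHS]lcs_bracket_pi.
Qed.

End LcsTransition.

Section Completion.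
Variable g : lieAlgType.

Definition towers : Type := forall n, lcs_quot g n.
HB.instance Definition _ := gen_eqMixin towers.
HB.instance Definition _ := gen_choiceMixin towers.

Lemma towersP (x y : towers) : (forall n, x n = y n) -> x = y.
Proof. exact: functional_extensionality_dep. Qed.

Definition tower_add (x y : towers) : towers := fun n => x n + y n.
Definition tower_opp (x : towers) : towers := fun n => - x n.
Definition tower_zero : towers := fun n => 0.

Fact tower_addA : associative tower_add.
Proof. by move=> x y z; apply: towersP => n; exact: addrA. Qed.
Fact tower_addC : commutative tower_add.
Proof. by move=> x y; apply: towersP => n; exact: addrC. Qed.
Fact tower_add0 : left_id tower_zero tower_add.
Proof. by move=> x; apply: towersP => n; exact: add0r. Qed.
Fact tower_addN : left_inverse tower_zero tower_opp tower_add.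
Proof. by move=> x; apply: towersP => n; exact: addNr. Qed.

HB.instance Definition _ :=
  GRing.isZmodule.Build towers tower_addA tower_addC tower_add0 tower_addN.

Definition compat_pred : {pred towers} :=
  [pred x : towers | `[< forall n, lcs_trans (x n.+1) = x n >]].

Lemma compat_closed : zmod_closed compat_pred.
Proof.
split; first by apply/asboolP => n; exact: raddf0.
move=> x y /asboolP hx /asboolP hy; apply/asboolP => n.
by rewrite -[RHS]/(x n - y n) -hx -hy -raddfB.
Qed.

HB.instance Definition _ := GRing.isZmodClosed.Build towers compat_pred compat_closed.

(** The inverse limit of the tower of the [g / gamma_(n+1)], [n >= 0]. *)
Definition completion : Type := {x : towers | x \in compat_pred}.

HB.instance Definition _ := SubChoice.on completion.
HB.instance Definition _ := [SubChoice_isSubZmodule of completion by <:].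

Lemma completionP (x y : completion) : (forall n, val x n = val y n) -> x = y.
Proof. by move=> h; apply: val_inj; exact: towersP. Qed.

Lemma compl_bracket_subproof (x y : completion) :
  (fun n => bracket (val x n) (val y n)) \in compat_pred.
Proof.
have /asboolP hx := valP x; have /asboolP hy := valP y.
by apply/asboolP => n; rewrite lcs_trans_bracket hx hy.
Qed.

Definition compl_bracket (x y : completion) : completion :=
  Sub (fun n => bracket (val x n) (val y n)) (compl_bracket_subproof x y).

Fact compl_bracketDl x y z :
  compl_bracket (x + y) z = compl_bracket x z + compl_bracket y z.
Proof. by apply: completionP => n; exact: bracketDl. Qed.
Fact compl_bracketDr x y z :
  compl_bracket x (y + z) = compl_bracket x y + compl_bracket x z.
Proof. by apply: completionP => n; exact: bracketDr. Qed.
Fact compl_bracketxx x : compl_bracket x x = 0.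
Proof. by apply: completionP => n; exact: bracketxx. Qed.
Fact compl_jacobi x y z :
  compl_bracket x (compl_bracket y z) + compl_bracket y (compl_bracket z x)
  + compl_bracket z (compl_bracket x y) = 0.
Proof. by apply: completionP => n; exact: jacobi. Qed.

HB.instance Definition _ := Zmodule_isLie.Build completion
  compl_bracketDl compl_bracketDr compl_bracketxx compl_jacobi.

Lemma to_completion_subproof (x : g) : (fun n => lcs_pi n x) \in compat_pred.
Proof. by apply/asboolP => n; exact: lcs_trans_pi. Qed.

Definition to_completion (x : g) : completion := Sub (fun n => lcs_pi n x) (to_completion_subproof x).

Lemma to_completion_additive : zmod_morphism to_completion.
Proof. by move=> x y; apply: completionP => n; exact: raddfB. Qed.
Lemma to_completion_lie x y :
  to_completion (bracket x y) = bracket (to_completion x) (to_completion y).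
Proof. by apply: completionP => n; exact/esym/lcs_bracket_pi. Qed.

HB.instance Definition _ :=
  GRing.isZmodMorphism.Build g completion to_completion to_completion_additive.
HB.instance Definition _ :=
  isLieMorphism.Build g completion to_completion to_completion_lie.

End Completion.

Section CompletionMap.
Variables (g h : lieAlgType) (f : {lie g -> h}).

Definition lcs_map n (x : lcs_quot g n) : lcs_quot h n := lcs_pi n (f (lcs_repr x)).

Lemma lcs_map_pi n x : lcs_map (lcs_pi n x) = lcs_pi n (f x).
Proof.
by apply/lcs_pi_eq; rewrite -raddfB; apply/lcs_morph/lcs_pi_eq; rewrite lcs_reprK.
Qed.

Lemma lcs_map_trans n x : lcs_trans (@lcs_map n.+1 x) = lcs_map (lcs_trans x).
Proof. by rewrite -[x]lcs_reprK lcs_map_pi !lcs_trans_pi lcs_map_pi. Qed.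

Lemma completion_map_subproof (x : completion g) :
  (fun n => lcs_map (val x n)) \in @compat_pred h.
Proof.
by have /asboolP hx := valP x; apply/asboolP => n; rewrite lcs_map_trans hx.
Qed.

Definition completion_map (x : completion g) : completion h :=
  Sub (fun n => lcs_map (val x n)) (completion_map_subproof x).

Lemma completion_map_additive : zmod_morphism completion_map.
Proof.
move=> x y; apply: completionP => n /=.
rewrite -[RHS]/(lcs_map (val x n) - lcs_map (val y n)).
rewrite -[LHS]/(lcs_map (val x n - val y n)).
rewrite -[val x n]lcs_reprK -[val y n]lcs_reprK -raddfB !lcs_map_pi.
by rewrite !raddfB.
Qed.

Lemma completion_map_lie x y :
  completion_map (bracket x y) = bracket (completion_map x) (completion_map y).
Proof.
apply: completionP => n /=.
rewrite -[RHS]/(lcs_bracket (lcs_map (val x n)) (lcs_map (val y n))).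
rewrite -[LHS]/(lcs_map (lcs_bracket (val x n) (val y n))).
rewrite -[val x n]lcs_reprK -[val y n]lcs_reprK.
move: (lcs_repr _) (lcs_repr _) => v u.
transitivity (lcs_pi n (f (bracket u v))); first by rewrite lcs_bracket_pi lcs_map_pi.
by rewrite !lcs_map_pi lcs_bracket_pi lie_morph.
Qed.

HB.instance Definition _ := GRing.isZmodMorphism.Build
  (completion g) (completion h) completion_map completion_map_additive.
HB.instance Definition _ := isLieMorphism.Build
  (completion g) (completion h) completion_map completion_map_lie.

End CompletionMap.

(** The universal enveloping algebra of [g] is the associative unital ring
    generated by the additive group [g], subject to the relations
    [x * y - y * x = bracket x y]; it is built as the quotient of the ring
    expressions over [g] by the least congruence [ueq] containing the ring
    axioms and these relations. *)
Section Enveloping.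
Variable g : lieAlgType.

Inductive uterm : Type :=
| UGen of g
| UZero
| UOne
| UOpp of uterm
| UAdd of uterm & uterm
| UMul of uterm & uterm.

Inductive ueq : uterm -> uterm -> Prop :=
| ueq_refl s : ueq s s
| ueq_sym s t : ueq s t -> ueq t s
| ueq_trans s t u : ueq s t -> ueq t u -> ueq s u
| ueq_opp s t : ueq s t -> ueq (UOpp s) (UOpp t)
| ueq_add s s' t t' : ueq s s' -> ueq t t' -> ueq (UAdd s t) (UAdd s' t')
| ueq_mul s s' t t' : ueq s s' -> ueq t t' -> ueq (UMul s t) (UMul s' t')
| ueq_addA s t u : ueq (UAdd s (UAdd t u)) (UAdd (UAdd s t) u)
| ueq_addC s t : ueq (UAdd s t) (UAdd t s)
| ueq_add0 s : ueq (UAdd UZero s) s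
| ueq_addN s : ueq (UAdd (UOpp s) s) UZero
| ueq_mulA s t u : ueq (UMul s (UMul t u)) (UMul (UMul s t) u)
| ueq_mul1 s : ueq (UMul UOne s) s
| ueq_mulr1 s : ueq (UMul s UOne) s
| ueq_mulDl s t u : ueq (UMul (UAdd s t) u) (UAdd (UMul s u) (UMul t u))
| ueq_mulDr s t u : ueq (UMul s (UAdd t u)) (UAdd (UMul s t) (UMul s u))
| ueq_genD x y : ueq (UGen (x + y)) (UAdd (UGen x) (UGen y))
| ueq_genB x y : ueq (UGen (bracket x y))
    (UAdd (UMul (UGen x) (UGen y)) (UOpp (UMul (UGen y) (UGen x)))).

Fixpoint uaug_term (t : uterm) : int :=
  match t with
  | UGen _ => 0
  | UZero => 0
  | UOne => 1
  | UOpp s => - uaug_term s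
  | UAdd s u => uaug_term s + uaug_term u
  | UMul s u => uaug_term s * uaug_term u
  end.

Lemma uaug_ueq s t : ueq s t -> uaug_term s = uaug_term t.
Proof.
elim=> //= *; try congruence;
  by rewrite ?(addrA, add0r, addNr, mulrA, mul1r, mulr1, mulrDl, mulrDr,
               mulr0, subr0) // addrC.
Qed.

HB.instance Definition _ := gen_eqMixin uterm.
HB.instance Definition _ := gen_choiceMixin uterm.

Definition ueqb (s t : uterm) : bool := `[< ueq s t >].

Lemma ueqb_equiv : equiv_class_of ueqb.
Proof.
split=> [s|s t|t s u]; first by apply/asboolP; exact: ueq_refl.
  by apply/asboolP/asboolP; exact: ueq_sym.
by move=> /asboolP st /asboolP tu; apply/asboolP; exact: ueq_trans st tu.
Qed.

Canonical ueqb_equivrel := EquivRelPack ueqb_equiv.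
Canonical ueqb_encModRel := defaultEncModRel ueqb.

Definition ug : Type := {eq_quot ueqb}.
HB.instance Definition _ := Choice.on ug.

Definition upi (t : uterm) : ug := \pi_{eq_quot ueqb} t.
Definition urepr (a : ug) : uterm := repr (a : {eq_quot ueqb}).

Lemma ureprK a : upi (urepr a) = a.
Proof. exact: (@reprK _ {eq_quot ueqb}). Qed.

Lemma upi_eq s t : upi s = upi t <-> ueq s t.
Proof.
split=> [h|h]; last by apply/eqmodP/asboolP.
by apply/asboolP; move/eqmodP: h.
Qed.

Lemma urepr_pi t : ueq (urepr (upi t)) t.
Proof. by apply/upi_eq; rewrite ureprK. Qed.

Definition uzero : ug := upi UZero.
Definition uone : ug := upi UOne.
Definition uopp (a : ug) : ug := upi (UOpp (urepr a)).
Definition uadd (a b : ug) : ug := upi (UAdd (urepr a) (urepr b)).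
Definition umul (a b : ug) : ug := upi (UMul (urepr a) (urepr b)).

Lemma uopp_pi s : uopp (upi s) = upi (UOpp s).
Proof. by apply/upi_eq/ueq_opp/urepr_pi. Qed.
Lemma uadd_pi s t : uadd (upi s) (upi t) = upi (UAdd s t).
Proof. by apply/upi_eq/ueq_add; exact: urepr_pi. Qed.
Lemma umul_pi s t : umul (upi s) (upi t) = upi (UMul s t).
Proof. by apply/upi_eq/ueq_mul; exact: urepr_pi. Qed.

Let upiE := (uopp_pi, uadd_pi, umul_pi).

Fact uaddA : associative uadd.
Proof.
move=> a b c; rewrite -[a]ureprK -[b]ureprK -[c]ureprK !upiE.
exact/upi_eq/ueq_addA.
Qed.
Fact uaddC : commutative uadd.
Proof.
move=> a b; rewrite -[a]ureprK -[b]ureprK !upiE; exact/upi_eq/ueq_addC.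
Qed.
Fact uadd0 : left_id uzero uadd.
Proof. move=> a; rewrite -[a]ureprK !upiE; exact/upi_eq/ueq_add0. Qed.
Fact uaddN : left_inverse uzero uopp uadd.
Proof. move=> a; rewrite -[a]ureprK !upiE; exact/upi_eq/ueq_addN. Qed.
Fact umulA : associative umul.
Proof.
move=> a b c; rewrite -[a]ureprK -[b]ureprK -[c]ureprK !upiE.
exact/upi_eq/ueq_mulA.
Qed.
Fact umul1 : left_id uone umul.
Proof. move=> a; rewrite -[a]ureprK !upiE; exact/upi_eq/ueq_mul1. Qed.
Fact umulr1 : right_id uone umul.
Proof. move=> a; rewrite -[a]ureprK !upiE; exact/upi_eq/ueq_mulr1. Qed.
Fact umulDl : left_distributive umul uadd.
Proof.
move=> a b c; rewrite -[a]ureprK -[b]ureprK -[c]ureprK !upiE.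
exact/upi_eq/ueq_mulDl.
Qed.
Fact umulDr : right_distributive umul uadd.
Proof.
move=> a b c; rewrite -[a]ureprK -[b]ureprK -[c]ureprK !upiE.
exact/upi_eq/ueq_mulDr.
Qed.
Fact uone_neq0 : uone != uzero.
Proof. by apply/eqP => /upi_eq /uaug_ueq. Qed.

HB.instance Definition _ := GRing.isZmodule.Build ug uaddA uaddC uadd0 uaddN.
HB.instance Definition _ := GRing.Zmodule_isNzRing.Build ug
  umulA umul1 umulr1 umulDl umulDr uone_neq0.

Definition ugen (x : g) : ug := upi (UGen x).

Definition uaug (a : ug) : int := uaug_term (urepr a).

Lemma uaug_pi t : uaug (upi t) = uaug_term t.
Proof. exact/uaug_ueq/urepr_pi. Qed.

Lemma uaug_additive : zmod_morphism uaug.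
Proof.
move=> a b; rewrite -[a]ureprK -[b]ureprK -[_ - _]/(uadd _ (uopp _)) !upiE.
by rewrite !uaug_pi.
Qed.

Lemma uaug_monoid : monoid_morphism uaug.
Proof.
split; first exact: uaug_pi.
by move=> a b; rewrite -[a]ureprK -[b]ureprK -[_ * _]/(umul _ _) !upiE !uaug_pi.
Qed.

HB.instance Definition _ := GRing.isZmodMorphism.Build ug int uaug uaug_additive.
HB.instance Definition _ := GRing.isMonoidMorphism.Build ug int uaug uaug_monoid.

End Enveloping.

(** [Z] as a trivial left, resp. right, module over [ug g]. *)
Definition trivl (g : lieAlgType) : Type := int.
Definition trivr (g : lieAlgType) : Type := int.

Section TrivialModules.
Variable g : lieAlgType.
Local Notation ug := (ug g).
Local Notation trivl := (trivl g).
Local Notation trivr := (trivr g).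

HB.instance Definition _ := GRing.Zmodule.on trivl.
Definition trivl_scale (a : ug) (n : trivl) : trivl := uaug a * n.

Fact trivl_scaleA a b n : trivl_scale a (trivl_scale b n) = trivl_scale (a * b) n.
Proof. by rewrite /trivl_scale rmorphM mulrA. Qed.
Fact trivl_scale1 : left_id 1 trivl_scale.
Proof. by move=> n; rewrite /trivl_scale rmorph1 mul1r. Qed.
Fact trivl_scaleDr : right_distributive trivl_scale +%R.
Proof. by move=> a m n; exact: mulrDr. Qed.
Fact trivl_scaleDl n : {morph trivl_scale^~ n : a b / a + b}.
Proof. by move=> a b; rewrite /trivl_scale rmorphD; exact: mulrDl. Qed.

HB.instance Definition _ := GRing.Zmodule_isLmodule.Build ug trivl
  trivl_scaleA trivl_scale1 trivl_scaleDr trivl_scaleDl.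

HB.instance Definition _ := GRing.Zmodule.on trivr.
Definition trivr_scale (a : ug^c) (n : trivr) : trivr := (n : int) * uaug a.

Fact trivr_scaleA a b n : trivr_scale a (trivr_scale b n) = trivr_scale (a * b) n.
Proof.
rewrite /trivr_scale -mulrA; congr (_ * _).
by rewrite -[a * b]/((b : ug) * (a : ug)) rmorphM.
Qed.
Fact trivr_scale1 : left_id 1 trivr_scale.
Proof. by move=> n; rewrite /trivr_scale -[1]/(1 : ug) rmorph1 mulr1. Qed.
Fact trivr_scaleDr : right_distributive trivr_scale +%R.
Proof. by move=> a m n; exact: mulrDl. Qed.
Fact trivr_scaleDl n : {morph trivr_scale^~ n : a b / a + b}.
Proof.
by move=> a b; rewrite /trivr_scale -[a + b]/((a : ug) + (b : ug)) rmorphD; exact: mulrDr.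
Qed.

HB.instance Definition _ := GRing.Zmodule_isLmodule.Build ug^c trivr
  trivr_scaleA trivr_scale1 trivr_scaleDr trivr_scaleDl.

Definition lie_homology (n : nat) : zmodType := Tor trivr trivl n.

End TrivialModules.

Section EnvelopingMap.
Variables (g h : lieAlgType) (f : {lie g -> h}).

Fixpoint umap_term (t : uterm g) : uterm h :=
  match t with
  | UGen x => UGen (f x)
  | UZero => UZero h
  | UOne => UOne h
  | UOpp s => UOpp (umap_term s)
  | UAdd s u => UAdd (umap_term s) (umap_term u)
  | UMul s u => UMul (umap_term s) (umap_term u)
  end.

Lemma umap_ueq s t : ueq s t -> ueq (umap_term s) (umap_term t).
Proof.
elim=> /= *; rewrite ?lie_morph ?raddfD; by eauto using ueq.
Qed.

Definition umap (a : ug g) : ug h := upi (umap_term (urepr a)).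

Lemma umap_pi t : umap (upi t) = upi (umap_term t).
Proof. exact/upi_eq/umap_ueq/urepr_pi. Qed.

Lemma umap_additive : zmod_morphism umap.
Proof.
move=> a b; rewrite -[a]ureprK -[b]ureprK.
rewrite -[X in umap X]/(uadd _ (uopp _)) -[RHS]/(uadd _ (uopp _)).
by rewrite !(uopp_pi, uadd_pi, umap_pi).
Qed.

Lemma umap_monoid : monoid_morphism umap.
Proof.
split; first exact: umap_pi.
move=> a b; rewrite -[a]ureprK -[b]ureprK.
by rewrite -[X in umap X]/(umul _ _) -[RHS]/(umul _ _) !(umul_pi, umap_pi).
Qed.

HB.instance Definition _ := GRing.isZmodMorphism.Build (ug g) (ug h) umap umap_additive.
HB.instance Definition _ := GRing.isMonoidMorphism.Build (ug g) (ug h) umap umap_monoid.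

Lemma uaug_umap a : uaug (umap a) = uaug a.
Proof.
by rewrite -[a]ureprK umap_pi !uaug_pi; elim: (urepr a) => //= [s ->|s -> t ->|s -> t ->].
Qed.

Definition trivl_map (n : trivl g) : trivl h := n.
Definition trivr_map (n : trivr g) : trivr h := n.

Fact trivl_map_additive : zmod_morphism trivl_map. Proof. by []. Qed.
Fact trivr_map_additive : zmod_morphism trivr_map. Proof. by []. Qed.
Fact trivl_map_scalable : scalable_for (umap \; *:%R) trivl_map.
Proof. by move=> a n; congr (_ * n); exact/esym/uaug_umap. Qed.
Fact trivr_map_scalable (a : ug g) (n : trivr g) :
  trivr_map ((a : (ug g)^c) *: n) = (umap a : (ug h)^c) *: trivr_map n.
Proof. by congr (n * _); exact/esym/uaug_umap. Qed.

HB.instance Definition _ :=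
  GRing.isZmodMorphism.Build (trivl g) (trivl h) trivl_map trivl_map_additive.
HB.instance Definition _ :=
  GRing.isScalable.Build (ug g) (trivl g) (trivl h) (umap \; *:%R) trivl_map
    trivl_map_scalable.
HB.instance Definition _ :=
  GRing.isZmodMorphism.Build (trivr g) (trivr h) trivr_map trivr_map_additive.

Definition lie_homology_map (n : nat) :
    {additive lie_homology g n -> lie_homology h n} :=
  Tor_map trivl_map trivr_map_scalable n.

End EnvelopingMap.

(* Main.v *)
Require Import Defs.
From HB Require Import structures.
From mathcomp Require Import all_boot all_order all_algebra.
From mathcomp Require Import finmap boolp classical_sets.
From mathcomp Require Import monalg.

(** Write [F], [G] for the completions of [f], [g] and [R] for the kernel of the
    surjection [F -> G]. By Hopf's formula the cokernel of [H_2 F -> H_2 G] is a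
    quotient of [R :&: [F, F]], so that the cokernel in question is a quotient of
    [R :&: [F, F]] by a subgroup containing the image of [r :&: [f, f]], where
    [r = ker (f -> g)]. That image is dense in [R :&: [F, F]], and the latter is
    complete because [f] is finitely generated. In such a quotient all the
    systems [b_n - (n+1) b_(n+1) = a_n] are solvable: replace each [a_n] by a
    representative in the [n]-th term of the filtration and sum the series
    [b_n = \sum_(j >= n) (j! / n!) a_j]. Solvability of these systems implies
    the vanishing of [Ext^1 (Q, -)], since [Q] is the union of the [Z (1 / n!)].

    The map from [R :&: [F, F]] does not require the Poincare-Birkhoff-Witt
    theorem: with [I] the augmentation ideal of an enveloping algebra,
    [Tor_2 (Z, Z)] is the kernel of the multiplication [I (x) I -> I], and the
    kernel [J] of [U F -> U G] is [R + J I + I J]. *)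

Set Implicit Arguments.
Unset Strict Implicit.
Unset Printing Implicit Defensive.

Import GRing.Theory Num.Theory.
Local Open Scope ring_scope.
Local Open Scope quotient_scope.

Local Notation "{ 'quot' I }" := (@Quotient.quot _ I) : type_scope.

(** * A criterion for cotorsion *)

Lemma quot_pi_eq0 (V : zmodType) (I : zmodClosed V) (x : V) :
  \pi_{quot I} x = 0 <-> x \in I.
Proof.
rewrite -(raddf0 \pi_{quot I}) -[x in x \in I]subr0 Quotient.idealrBE.
by split=> /eqP.
Qed.

Lemma diffB (R : nzRingType) (s : arrow R) x y :
  diff s (x - y) = diff s x - diff s y.
Proof. exact: raddfB. Qed.

Section NextArrow.
Variables (R : nzRingType) (s : arrow R).

Lemma diff_next (u : src (next_arrow s)) : diff s (diff (next_arrow s) u) = 0.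
Proof.
rewrite /= /linext /lext raddf_sum big1 // => k _ /=.
by rewrite linearZ /= (eqP (valP k)) scaler0.
Qed.

(** Total, with value [0] off the cycles, so that generators can be indexed by [src s] and the cycle
    condition enters only in the equations. *)
Definition cyc (x : src s) : modker (diff s) := insubd 0 x.

Lemma cycK x : diff s x = 0 -> val (cyc x) = x.
Proof. by move=> /eqP hx; rewrite /cyc insubdK. Qed.

(** Locked because unifying two distinct generators [<< x >>] by unfolding is
    intractable. *)
Definition kgen : src s -> src (next_arrow s) := locked (fun x => << cyc x >>).

Lemma kgenE x : kgen x = << cyc x >>.
Proof. by rewrite /kgen -lock. Qed.

Lemma diff_kgen x : diff s x = 0 -> diff (next_arrow s) (kgen x) = x.
Proof. by move=> hx; rewrite kgenE [LHS]linextU scale1r cycK. Qed.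

End NextArrow.

Lemma zkerP (B C : zmodType) (g : {additive B -> C}) (z : zker g) : g (val z) = 0.
Proof. exact: (eqP (valP z)). Qed.

(** Exactness of the resolution: a cycle [u] is the boundary of the generator [kgen u]. *)
Lemma precomp_cycle (R : nzRingType) (A : lmodType R) (s : arrow R)
    (phi : Defs.hom (src s) A) :
  precomp (diff (next_arrow s)) phi = 0 -> forall u, diff s u = 0 -> val phi u = 0.
Proof.
move=> h u hu; rewrite -[u](diff_kgen hu).
exact: (congr1 (fun f : Defs.hom _ A => val f (kgen u)) h).
Qed.

(** A cocycle [phi] takes equal values on chains with equal boundary, so it factors through the
    function [phi (kgen x)] of the cycle [x], which is additive for the same reason. A linear
    extension of that function to [src s] has coboundary [phi]. *)
Lemma cocycle_coboundary (R : nzRingType) (A : lmodType R) (s : arrow R)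
    (phi : Defs.hom (src (next_arrow s)) A) :
  (forall psi : src s -> A,
     (forall x y, diff s x = 0 -> diff s y = 0 -> psi (x - y) = psi x - psi y) ->
     exists chi : {linear src s -> A}, forall x, diff s x = 0 -> chi x = psi x) ->
  precomp (diff (next_arrow (next_arrow s))) phi = 0 ->
  exists chi, precomp (diff (next_arrow s)) chi = phi.
Proof.
move=> ext /precomp_cycle phi_cycle; have /asboolP philin := valP phi.
have phiB u v : val phi (u - v) = val phi u - val phi v.
  by rewrite addrC -scaleN1r philin scaleN1r addrC.
have phi_eq u v : diff (next_arrow s) (u - v) = 0 -> val phi u = val phi v.
  by move=> /phi_cycle; rewrite phiB => /eqP; rewrite subr_eq0 => /eqP.
have de := @diff_kgen _ s.
have psiB x y : diff s x = 0 -> diff s y = 0 ->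
    val phi (kgen (x - y)) = val phi (kgen x) - val phi (kgen y).
  move=> hx hy; rewrite -(phiB (kgen x)); apply: phi_eq.
  have hxy : diff s (x - y) = 0 by rewrite diffB hx hy subrr.
  by rewrite diffB (diffB (kgen x)) (de _ hxy) (de _ hx) (de _ hy) subrr.
have [chi chiE] := ext _ psiB.
have chiP : (chi : src s -> A) \in @hom_pred _ (src s) A.
  by apply/asboolP; exact: linearP.
exists (Sub (chi : src s -> A) chiP); apply: val_inj.
apply: funext => u; rewrite -[LHS]/(chi (diff (next_arrow s) u)).
have du := diff_next u; rewrite chiE //; apply: phi_eq.
by rewrite diffB de // subrr.
Qed.

Lemma ext1_eq0 (R : nzRingType) (N A : lmodType R) (x : Ext N A 1) :
  (forall psi : src (resol N 0) -> A,
     (forall x y, diff (resol N 0) x = 0 -> diff (resol N 0) y = 0 ->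
       psi (x - y) = psi x - psi y) ->
     exists chi : {linear src (resol N 0) -> A},
       forall x, diff (resol N 0) x = 0 -> chi x = psi x) ->
  x = 0.
Proof.
move=> ext; rewrite -[x]reprK; move: (repr x) => z {x}; apply/quot_pi_eq0.
by apply/asboolP; exact: (cocycle_coboundary ext (zkerP z)).
Qed.

(** * Extending additive maps from the relations of [Q] to its free cover *)

Section RationalExtension.
Variable A : zmodType.
Hypothesis A_system : forall a : nat -> A,
  exists b : nat -> A, forall n, b n - b n.+1 *+ n.+1 = a n.

Local Notation FQ := {malg int[zmodule rat]}.
Local Notation d := (linext (@id (zmodule rat)) : {linear FQ -> zmodule rat}).

Variable psi : FQ -> A.
Hypothesis psiB : forall x y, d x = 0 -> d y = 0 -> psi (x - y) = psi x - psi y.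

Let t (n : nat) : FQ := << (n`!%:R^-1 : rat) >>.

(** [b n] is the value to be given to the extension at [t n]; the relation [t n - t n.+1 *+ n.+1] in
    the kernel of [d] forces exactly a system solved by [A_system]. Every other generator differs
    from an integral multiple of some [t n] by an element of the kernel, so its value is then
    determined. *)
Lemma rational_extension : exists chi : {linear FQ -> zmodule A},
  forall x, d x = 0 -> chi x = psi x.
Proof.
have dt n : d (t n) = n`!%:R^-1 :> rat.
  by rewrite [LHS]linextU scale1r.
have fact_neq0 n : n`!%:R != 0 :> rat by rewrite pnatr_eq0 -lt0n fact_gt0.
have psi0 : psi 0 = 0 by have := psiB (raddf0 _) (raddf0 _); rewrite !subrr.
have psiN x : d x = 0 -> psi (- x) = - psi x.
  by move=> hx; rewrite -[- x]sub0r psiB ?raddf0 // psi0 sub0r.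
have psiD x y : d x = 0 -> d y = 0 -> psi (x + y) = psi x + psi y.
  by move=> hx hy; rewrite -[y]opprK psiB ?psiN ?raddfN /= ?hy ?oppr0 // opprK.
have psiMn x n : d x = 0 -> psi (x *+ n) = psi x *+ n.
  move=> hx; elim: n => [|n IH]; first exact: psi0.
  by rewrite !mulrSr psiD ?IH // raddfMn /= hx mul0rn.
have psiMz x (m : int) : d x = 0 -> psi (x *~ m) = psi x *~ m.
  move=> hx; case: m => n; first exact: psiMn.
  by rewrite NegzE !mulrNz psiN ?psiMn // raddfMn /= hx mul0rn.
pose kn n := t n - t n.+1 *+ n.+1.
have dkn n : d (kn n) = 0.
  rewrite /kn raddfB raddfMn /= !dt; apply/eqP; rewrite subr_eq0; apply/eqP.
  apply: (mulfI (fact_neq0 n.+1)); rewrite mulrnAr mulfV //.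
  by rewrite factS natrM -mulrA mulfV // mulr1.
have [b hb] := A_system (fun n => psi (kn n)).
(* [D] divides [D!], so the factorial of the denominator makes [q] integral. *)
pose lev (q : rat) : nat := `|denq q|%N.
pose num (q : rat) : int := numq (q * (lev q)`!%:R).
have numE q : (num q)%:~R = (lev q)`!%:R * q :> rat.
  rewrite /num /lev; set D := `|denq q|%N.
  have /dvdnP[k ->] : (D %| D`!)%N by rewrite dvdn_fact // absz_gt0 denq_neq0 leqnn.
  have e : q * (k * D)%:R = (k%:Z * numq q)%:~R.
    by rewrite intrM numqE -absz_denq -/D natrM mulrCA.
  by rewrite e numq_int -e mulrC.
pose chi : {linear FQ -> zmodule A} := linext (fun q : zmodule rat =>
  psi (<< q >> - t (lev q) *~ num q) + b (lev q) *~ num q : zmodule A).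
exists chi.
(* At a level [N] clearing the denominator of [d x], the value of [chi] is the one dictated by [psi]
   and [b N]. The property is additive in [x] and passes to higher levels; when [d x = 0] it has
   [m = 0] and reads [chi x = psi x]. *)
pose good N x := exists m : int,
  m%:~R = N`!%:R * d x :> rat /\ chi x = psi (x - t N *~ m) + b N *~ m.
have dsub N x (m : int) : m%:~R = N`!%:R * d x :> rat -> d (x - t N *~ m) = 0.
  move=> e; rewrite raddfB raddfMz /= dt -mulrzl e mulrAC.
  by rewrite mulfV // mul1r subrr.
have goodS N x : good N x -> good N.+1 x.
  case=> m [em ex]; exists (m * N.+1).
  have -> : (m * N.+1)%:~R = N.+1`!%:R * d x :> rat.
    by rewrite factS natrM intrM em mulrC mulrA.
  split=> //; rewrite ex.
  (* Raising the level trades [t N] for [t N.+1 *+ N.+1 + kn N]; the equation between [b N] and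
     [b N.+1] absorbs the resulting [psi (kn N)]. *)
  have -> : x - t N.+1 *~ (m * N.+1) = x - t N *~ m + kn N *~ m.
    rewrite /kn mulrzBl addrA subrK; congr (_ - _).
    by rewrite mulrC mulrzA.
  have dknm : d (kn N *~ m) = 0 by rewrite raddfMz /= dkn mul0rz.
  rewrite (psiD _ _ (dsub _ _ _ em) dknm) psiMz // -hb mulrzBl.
  by rewrite -addrA; congr (_ + _); rewrite mulrC mulrzA subrK.
have good_le N M x : (N <= M)%N -> good N x -> good M x.
  by move=> /subnK <-; elim: (M - N)%N => // k IH /IH; exact: goodS.
have goodB N x y : good N x -> good N y -> good N (x - y).
  case=> m [em ex] [m' [em' ey]]; exists (m - m').
  rewrite intrB em em' raddfB mulrBr; split=> //.
  have -> : x - y - t N *~ (m - m') = (x - t N *~ m) - (y - t N *~ m').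
    by rewrite mulrzBr !opprB addrACA [RHS]addrACA [- y - _]addrC.
  by rewrite psiB ?dsub // raddfB /= ex ey mulrzBr opprD addrACA.
have good0 N : good N 0.
  exists 0; split; first by rewrite [X in _ * X]raddf0 mulr0.
  by rewrite [LHS]raddf0 !mulr0z subr0 psi0 addr0.
have goodMz N x (m : int) : good N x -> good N (x *~ m).
  have posn n : good N x -> good N (x *+ n).
    move=> hx; elim: n => [|n IH]; first exact: good0.
    rewrite mulrSr -[x in _ + x]opprK; apply: (goodB) => //.
    by rewrite -sub0r; apply: (goodB).
  move=> hx; case: m => n; first exact: (posn).
  by rewrite NegzE mulrNz -sub0r; apply: (goodB) => //; exact: (posn).
have goodE x : exists N, good N x.
  rewrite [x]monalgE; elim/big_ind: _ => [|u v [N hu] [M hv]|q _].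
  - by exists 0%N.
  - exists (maxn N M); rewrite -[v]opprK -[- v]sub0r; apply: (goodB).
      exact: good_le (leq_maxl _ _) hu.
    apply: (goodB); [exact: good0|exact: good_le (leq_maxr _ _) hv].
  - exists (lev q); have -> : << x@_q *g q >> = << q >> *~ x@_q :> FQ.
      by rewrite -raddfMz /= intz.
    apply: goodMz; exists (num q); rewrite numE.
    split; first by rewrite [d _]linextU scale1r.
    by rewrite [chi _]linextU scale1r.
move=> x dx; have [N [m [em ->]]] := goodE x.
move: em; rewrite dx mulr0 => /eqP; rewrite intr_eq0 => /eqP->.
by rewrite !mulr0z subr0 addr0.
Qed.

End RationalExtension.

Lemma cotorsion_system (A : zmodType) :
  (forall a : nat -> A, exists b : nat -> A, forall n, b n - b n.+1 *+ n.+1 = a n) ->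
  cotorsion A.
Proof.
by move=> A_system x; apply: ext1_eq0 => psi; exact: rational_extension.
Qed.

(** * Completions *)

Lemma bracketNl (F : lieAlgType) (x y : F) : bracket (- x) y = - bracket x y.
Proof. by rewrite -sub0r bracketBl bracket0l sub0r. Qed.

Section GeneratedSubalgebra.
Variables (F : lieAlgType) (X : Type) (b : X -> F).

Inductive lie_span : set F :=
| lie_span_gen i : lie_span (b i)
| lie_span_zero : lie_span 0
| lie_span_sub x y : lie_span x -> lie_span y -> lie_span (x - y)
| lie_span_bracket x y : lie_span x -> lie_span y -> lie_span (bracket x y).

Definition lie_span_pred : {pred F} := [pred x | `[< lie_span x >]].

Lemma lie_span_closed : zmod_closed lie_span_pred.
Proof.
split; first by apply/asboolP; exact: lie_span_zero.
by move=> x y /asboolP hx /asboolP hy; apply/asboolP; exact: lie_span_sub.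
Qed.

HB.instance Definition _ :=
  GRing.isZmodClosed.Build F lie_span_pred lie_span_closed.

Definition lie_sub : Type := {x : F | x \in lie_span_pred}.

HB.instance Definition _ := SubChoice.on lie_sub.
HB.instance Definition _ := [SubChoice_isSubZmodule of lie_sub by <:].

Lemma lie_sub_bracket_subproof (x y : lie_sub) :
  bracket (val x) (val y) \in lie_span_pred.
Proof.
have /asboolP hx := valP x; have /asboolP hy := valP y.
by apply/asboolP; exact: lie_span_bracket.
Qed.

Definition lie_sub_bracket (x y : lie_sub) : lie_sub :=
  Sub (bracket (val x) (val y)) (lie_sub_bracket_subproof x y).

Fact lie_sub_bracketDl x y z :
  lie_sub_bracket (x + y) z = lie_sub_bracket x z + lie_sub_bracket y z.
Proof. by apply: val_inj; exact: bracketDl. Qed.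
Fact lie_sub_bracketDr x y z :
  lie_sub_bracket x (y + z) = lie_sub_bracket x y + lie_sub_bracket x z.
Proof. by apply: val_inj; exact: bracketDr. Qed.
Fact lie_sub_bracketxx x : lie_sub_bracket x x = 0.
Proof. by apply: val_inj; exact: bracketxx. Qed.
Fact lie_sub_jacobi x y z :
  lie_sub_bracket x (lie_sub_bracket y z) + lie_sub_bracket y (lie_sub_bracket z x)
  + lie_sub_bracket z (lie_sub_bracket x y) = 0.
Proof. by apply: val_inj; exact: jacobi. Qed.

HB.instance Definition _ := Zmodule_isLie.Build lie_sub
  lie_sub_bracketDl lie_sub_bracketDr lie_sub_bracketxx lie_sub_jacobi.

Definition lie_sub_val (x : lie_sub) : F := val x.

Fact lie_sub_val_additive : zmod_morphism lie_sub_val.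
Proof. exact: raddfB. Qed.
Fact lie_sub_val_bracket x y :
  lie_sub_val (bracket x y) = bracket (lie_sub_val x) (lie_sub_val y).
Proof. by []. Qed.

HB.instance Definition _ :=
  GRing.isZmodMorphism.Build lie_sub F lie_sub_val lie_sub_val_additive.
HB.instance Definition _ :=
  isLieMorphism.Build lie_sub F lie_sub_val lie_sub_val_bracket.

(** Freeness gives a map from [F] to the subalgebra generated by [b]. Followed by the inclusion it
    agrees with the identity on [b], hence everywhere by uniqueness. *)
Lemma lie_free_span (x : F) : lie_free b -> lie_span x.
Proof.
move=> free; have bS i : b i \in lie_span_pred by apply/asboolP; exact: lie_span_gen.
have [phi [phib _]] := free _ (fun i => Sub (b i) (bS i) : lie_sub).
have [psi [_ uniq]] := free _ b.
pose phi' := lie_sub_val \o phi.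
have phi'B : zmod_morphism phi' by move=> u v; rewrite /phi' /= !raddfB.
have phi'L u v : phi' (bracket u v) = bracket (phi' u) (phi' v).
  by rewrite /phi' /= !lie_morph.
pose Phi : {lie F -> F} := HB.pack_for {lie F -> F} phi'
  (GRing.isZmodMorphism.Build F F phi' phi'B) (isLieMorphism.Build F F phi' phi'L).
have idB : zmod_morphism (@id F) by [].
have idL u v : @id F (bracket u v) = bracket (id u) (id v) by [].
pose Id : {lie F -> F} := HB.pack_for {lie F -> F} (@id F)
  (GRing.isZmodMorphism.Build F F id idB) (isLieMorphism.Build F F id idL).
have e1 : Phi x = psi x by apply: uniq => i; rewrite /= /phi' /= phib.
have e2 : Id x = psi x by apply: uniq.
rewrite -[x]/(Id x) e2 -e1; exact/asboolP/(valP (phi x)).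
Qed.

End GeneratedSubalgebra.

Section LcsGenerators.
Variables (F : lieAlgType) (r : nat) (b : 'I_r -> F).
Hypothesis bF : forall x, lie_span b x.

(** Induction on the construction of [x] from the generators. For a bracket, the Jacobi identity
    gives [[u, [x, y]] = [[u, x], y] - [[u, y], x]], where [[u, x]] and [[u, y]] stay in the same
    term of the series as [u]. *)
Lemma bracket_span n (x u : F) : u \in lcs_pred F n ->
  exists2 w : 'I_r -> F, forall i, w i \in lcs_pred F n &
    bracket u x = \sum_i bracket (w i) (b i).
Proof.
elim: (bF x) n u => {x} [i| |x y _ hx _ hy|x y _ hx _ hy] n u hu.
- exists (fun j => if j == i then u else 0) => [j|].
    by case: eqP => // _; exact: rpred0.
  rewrite (bigD1 i) //= eqxx big1 ?addr0 // => j /negbTE->.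
  exact: bracket0l.
- exists (fun=> 0) => [j|]; first exact: rpred0.
  rewrite big1 => [|j _]; last exact: bracket0l.
  by rewrite bracketC bracket0l oppr0.
- have [v hv ev] := hx n u hu; have [w hw ew] := hy n u hu.
  exists (fun j => v j - w j) => [j|]; first exact: rpredB.
  rewrite bracketBr ev ew -sumrB; apply: eq_bigr => j _.
  by rewrite bracketBl.
- have hux : bracket u x \in lcs_pred F n by exact: lcs_bracketl.
  have huy : bracket u y \in lcs_pred F n by exact: lcs_bracketl.
  have [v hv ev] := hy n _ hux; have [w hw ew] := hx n _ huy.
  exists (fun j => v j - w j) => [j|]; first exact: rpredB.
  suff -> : bracket u (bracket x y) = bracket (bracket u x) y - bracket (bracket u y) x.
    by rewrite ev ew -sumrB; apply: eq_bigr => j _; rewrite bracketBl.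
  have /eqP := jacobi u x y; rewrite -addrA addr_eq0 => /eqP->.
  rewrite (bracketC y (bracket u x)) (bracketC x (bracket y u)) (bracketC y u).
  by rewrite bracketNl opprK opprB.
Qed.

(** The same [r] generators serve for every [n], which later lets an infinite series of commutators
    be regrouped into [r] brackets. *)
Lemma lcsS_span n (u : F) : u \in lcs_pred F n.+1 ->
  exists2 w : 'I_r -> F, forall i, w i \in lcs_pred F n &
    u = \sum_i bracket (w i) (b i).
Proof.
move=> /lcs_predP; elim=> [{}u [x [y [/lcs_predP hx ->]]]| |x y _ [v hv ev] _ [w hw ew]].
- exact: bracket_span.
- exists (fun=> 0) => [j|]; first exact: rpred0.
  by rewrite big1 // => j _; exact: bracket0l.
- exists (fun j => v j - w j) => [j|]; first exact: rpredB.
  by rewrite ev ew -sumrB; apply: eq_bigr => j _; rewrite bracketBl.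
Qed.

End LcsGenerators.

Section LcsLift.
Variables (F G : lieAlgType) (p : {lie F -> G}).
Hypothesis p_surj : forall y : G, exists x : F, p x = y.

Lemma lcs_lift n (y : G) : y \in lcs_pred G n ->
  exists2 x, x \in lcs_pred F n & p x = y.
Proof.
elim: n y => [|n IH] y.
  by move=> _; have [x <-] := p_surj y; exists x => //; exact/(@lcs_predP F 0).
move=> /lcs_predP; elim=> [{}y [u [v [/lcs_predP/IH[u' hu' <-] ->]]]| |].
- have [v' <-] := p_surj v; exists (bracket u' v'); last exact: lie_morph.
  by apply/lcs_predP/zspan_gen; exists u', v'; split=> //; exact/lcs_predP.
- by exists 0; [exact: rpred0|rewrite raddf0].
- move=> _ _ _ [x hx <-] _ [x' hx' <-].
  by exists (x - x'); [exact: rpredB|rewrite raddfB].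
Qed.

End LcsLift.

Section CauchySequences.
Variables (F : lieAlgType) (s : nat -> F).
Hypothesis cauchy_s : forall n, s n.+1 - s n \in lcs_pred F n.

Lemma compl_lim_subproof : (fun n => lcs_pi n (s n)) \in @compat_pred F.
Proof. by apply/asboolP => n; rewrite lcs_trans_pi; exact/lcs_pi_eq. Qed.

Definition compl_lim : completion F := Sub (fun n => lcs_pi n (s n)) compl_lim_subproof.

End CauchySequences.

Lemma compl_repr_cauchy (F : lieAlgType) (x : completion F) n :
  lcs_repr (val x n.+1) - lcs_repr (val x n) \in lcs_pred F n.
Proof.
have /asboolP hx := valP x; apply/lcs_pi_eq.
by rewrite lcs_reprK -lcs_trans_pi lcs_reprK hx.
Qed.

Section CompletionSurjection.
Variables (F G : lieAlgType) (p : {lie F -> G}).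
Hypothesis p_surj : forall y : G, exists x : F, p x = y.

(** Lifting each level separately would not give a compatible tower. Instead the differences of
    consecutive representatives are lifted inside [lcs k], and the partial sums of these lifts
    converge. *)
Lemma completion_map_surj (y : completion G) : exists x, completion_map p x = y.
Proof.
have lift n (z : G) : exists x, z \in lcs_pred G n -> x \in lcs_pred F n /\ p x = z.
  have [/(lcs_lift p_surj)[x hx <-]|] := boolP (z \in lcs_pred G n); last by exists 0.
  by exists x.
pose L n z := projT1 (cid (lift n z)).
have LP n z : z \in lcs_pred G n -> L n z \in lcs_pred F n /\ p (L n z) = z.
  exact: (projT2 (cid (lift n z))).
pose t n : G := lcs_repr (val y n).
pose s n := L 0 (t 0) + \sum_(k < n) L k (t k.+1 - t k).
have hs n : s n.+1 - s n \in lcs_pred F n.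
  rewrite /s big_ord_recr /= addrA [X in X - _]addrC addrK.
  by case: (LP n _ (compl_repr_cauchy y n)).
have ps n : p (s n) = t n.
  rewrite /s raddfD raddf_sum /= (LP 0 (t 0) _).2; last exact/(@lcs_predP G 0).
  elim: n => [|n IH]; first by rewrite big_ord0 addr0.
  rewrite big_ord_recr /= addrA IH (LP n _ (compl_repr_cauchy y n)).2.
  by rewrite addrC subrK.
exists (compl_lim hs); apply: completionP => n.
by rewrite -[LHS]/(lcs_map p (lcs_pi n (s n))) lcs_map_pi ps lcs_reprK.
Qed.

(** A representative of [x] at level [n] maps into [lcs n]; subtracting an element of [lcs n] with
    the same image moves it into [ker p] without changing its class. *)
Lemma completion_map_ker_dense (x : completion F) n : completion_map p x = 0 ->
  exists2 r, p r = 0 & val (x - to_completion r) n = 0.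
Proof.
move=> /(congr1 (fun z => val z n)); rewrite -[LHS]/(lcs_map p (val x n)).
rewrite -[val x n]lcs_reprK lcs_map_pi -[RHS](raddf0 (lcs_pi n)).
move=> /lcs_pi_eq; rewrite subr0 => /(lcs_lift p_surj)[u hu pu].
exists (lcs_repr (val x n) - u); first by rewrite raddfB /= pu subrr.
rewrite -[LHS]/(val x n - lcs_pi n (lcs_repr (val x n) - u)) raddfB /= lcs_reprK.
rewrite opprB addrC subrK -(raddf0 (lcs_pi n)); apply/lcs_pi_eq; by rewrite subr0.
Qed.

End CompletionSurjection.

Lemma lcs1_compl (F : lieAlgType) (x : completion F) :
  x \in lcs_pred (completion F) 1 -> val x 1 = 0.
Proof.
move=> /lcs_predP; elim=> [{}x [u [v [_ ->]]]| |u v _ hu _ hv] //.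
- rewrite -[LHS]/(lcs_bracket (val u 1%N) (val v 1%N)).
  rewrite -[val u 1%N]lcs_reprK -[val v 1%N]lcs_reprK lcs_bracket_pi.
  rewrite -(raddf0 (lcs_pi 1)); apply/lcs_pi_eq; rewrite subr0.
  by apply/lcs_predP/zspan_gen; eexists; eexists.
- by rewrite -[LHS]/(val u 1%N - val v 1%N) hu hv subrr.
Qed.

(** Telescoping representatives writes [x] as a series of terms [d n], each a sum of brackets of
    some [w n i] with [b i]. For fixed [i] the [w n i] are summable, so [x] is a finite sum of [r]
    brackets in the completion. *)
Lemma compl_lcs1 (F : lieAlgType) (r : nat) (b : 'I_r -> F) (x : completion F) :
  (forall y, lie_span b y) -> val x 1 = 0 -> x \in lcs_pred (completion F) 1.
Proof.
(* Representatives start at level [1], so that [t 0] already lies in [lcs 1]. *)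
move=> bF x1; pose t n := lcs_repr (val x n.+1).
pose d n := if n is m.+1 then t m.+1 - t m else t 0.
have hd n : d n \in lcs_pred F n.-1.+1.
  case: n => [|n]; last exact: compl_repr_cauchy.
  rewrite -[d 0]subr0; apply/lcs_pi_eq; rewrite lcs_reprK raddf0; exact: x1.
have dec n : exists w : 'I_r -> F, (forall i, w i \in lcs_pred F n.-1) /\
    d n = \sum_i bracket (w i) (b i).
  by have [w hw ew] := lcsS_span bF (hd n); exists w.
have [w /all_and2[hw ew]] := choice dec.
pose s i n := \sum_(k < n.+1) w k i.
have hs i n : s i n.+1 - s i n \in lcs_pred F n.
  rewrite /s big_ord_recr /= [X in X - _]addrC addrK; exact: (hw n.+1).
have -> : x = \sum_i bracket (compl_lim (hs i)) (to_completion (b i)).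
  apply: completionP => n; pose ev (z : completion F) : lcs_quot F n := val z n.
  have evB : zmod_morphism ev by [].
  pose Ev : {additive completion F -> lcs_quot F n} := HB.pack_for
    {additive completion F -> lcs_quot F n} ev (GRing.isZmodMorphism.Build _ _ ev evB).
  rewrite -[RHS]/(Ev _) raddf_sum.
  transitivity (lcs_pi n (t n)).
    have /asboolP hx := valP x.
    by rewrite -lcs_trans_pi lcs_reprK hx.
  have -> : t n = \sum_(k < n.+1) d k.
    elim: n {ev evB Ev} => [|n IH]; first by rewrite big_ord1.
    by rewrite big_ord_recr /= -IH addrC subrK.
  under eq_bigr do rewrite ew.
  rewrite exchange_big raddf_sum; apply: eq_bigr => i _.
  rewrite -[RHS]/(lcs_bracket (lcs_pi n (s i n)) (lcs_pi n (b i))) lcs_bracket_pi.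
  congr (lcs_pi n _); rewrite /s.
  elim/big_rec2: _ => [|k u v _ ->]; first by rewrite bracket0l.
  by rewrite bracketDl.
apply: rpred_sum => i _; apply/lcs_predP/zspan_gen.
by exists (compl_lim (hs i)), (to_completion (b i)).
Qed.

(** With [a n] tending to [0], the series [b n = \sum_(j >= n) (j! / n!) a j]
    converges. *)
Lemma compl_divisible_system (F : lieAlgType) (a : nat -> completion F) :
  (forall n, val (a n) n = 0) ->
  exists b : nat -> completion F,
    (forall n, b n - b n.+1 *+ n.+1 = a n) /\
    (forall (G : lieAlgType) (p : {lie F -> G}),
       (forall n, completion_map p (a n) = 0) -> forall n, completion_map p (b n) = 0) /\
    (forall m, (forall n, val (a n) m = 0) -> forall n, val (b n) m = 0).
Proof.
move=> a0.
have a_compat n m : lcs_trans (val (a n) m.+1) = val (a n) m.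
  by have /asboolP := valP (a n).
have a_le n m : (m <= n)%N -> val (a n) m = 0.
  move=> /subnK; move: (n - m)%N => k; elim: k m => [|k IH] m; first by rewrite add0n => ->.
  by rewrite addSnnS => /IH h; rewrite -a_compat h raddf0.
(* The coefficient [j! / n!], extended by [0] to [j < n] so that all the series run over the same
   indices. *)
pose c n j := if (n <= j)%N then (\prod_(n <= i < j) i.+1)%N else 0%N.
have cS n j : c n j = (c n.+1 j * n.+1 + (j == n))%N.
  rewrite /c; case: ltngtP => [lt_nj|//|->]; last by rewrite big_geq.
  by rewrite big_ltn // addn0 mulnC.
(* The terms with [j >= m] vanish at level [m], so this finite sum is the whole series there. *)
pose bs n : towers F := fun m => \sum_(j < m) val (a j) m *+ c n j.
have bs_compat n : bs n \in @compat_pred F.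
  apply/asboolP => m; rewrite /bs raddf_sum big_ord_recr /= raddfMn /= a_compat.
  rewrite a_le // mul0rn addr0; apply: eq_bigr => j _.
  by rewrite raddfMn /= a_compat.
pose b n : completion F := Sub (bs n) (bs_compat n).
exists b; split; last split.
- move=> n; apply/eqP; rewrite subr_eq; apply/eqP/completionP => m.
  pose ev (z : completion F) : lcs_quot F m := val z m.
  have evB : zmod_morphism ev by [].
  pose Ev : {additive completion F -> lcs_quot F m} := HB.pack_for
    {additive completion F -> lcs_quot F m} ev (GRing.isZmodMorphism.Build _ _ ev evB).
  rewrite -[LHS]/(\sum_(j < m) val (a j) m *+ c n j) -[RHS]/(Ev _).
  rewrite raddfD raddfMn -[Ev (b _)]/(\sum_(j < m) val (a j) m *+ c n.+1 j).
  under eq_bigr do rewrite cS mulrnDr mulrnA.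
  rewrite big_split /= -sumrMnl addrC; congr (_ + _).
  have [lt_nm|le_mn] := ltnP n m; last first.
    rewrite -[RHS]/(val (a n) m) a_le // big1 // => j _.
    by case: eqP => // e; move: (ltn_ord j); rewrite e ltnNge le_mn.
  rewrite (bigD1 (Ordinal lt_nm)) //= eqxx big1 ?addr0 // => j.
  by rewrite -val_eqE /= => /negbTE->.
- move=> G p pa n; apply: completionP => m.
  have lB : zmod_morphism (@lcs_map F G p m).
    move=> x y; rewrite -[x]lcs_reprK -[y]lcs_reprK -raddfB !lcs_map_pi.
    by rewrite !raddfB.
  pose l : {additive lcs_quot F m -> lcs_quot G m} := HB.pack_for
    {additive lcs_quot F m -> lcs_quot G m} (@lcs_map F G p m)
    (GRing.isZmodMorphism.Build _ _ _ lB).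
  rewrite -[LHS]/(l (bs n m)) raddf_sum big1 // => j _.
  by rewrite raddfMn -[l _]/(val (completion_map p (a j)) m) pa mul0rn.
- move=> m am n; rewrite -[LHS]/(\sum_(j < m) val (a j) m *+ c n j) big1 // => j _.
  by rewrite am mul0rn.
Qed.

(** * Enveloping algebras and the kernel of [ug F -> ug G] *)

Section Abelianization.
Variable F : lieAlgType.

(** The derivation over the augmentation that extends the projection [F -> F / [F, F]]. *)
Fixpoint uabel_term (t : uterm F) : lcs_quot F 1 :=
  match t with
  | UGen x => lcs_pi 1 x
  | UZero => 0
  | UOne => 0
  | UOpp s => - uabel_term s
  | UAdd s u => uabel_term s + uabel_term u
  | UMul s u => uabel_term u *~ uaug_term s + uabel_term s *~ uaug_term u
  end.

Lemma lcs_pi1_bracket (x y : F) : lcs_pi 1 (bracket x y) = 0.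
Proof.
rewrite -[0](raddf0 (@lcs_pi F 1)); apply/lcs_pi_eq; rewrite subr0.
by apply/lcs_predP; apply: zspan_gen; exists x, y.
Qed.

Lemma uabel_ueq s t : ueq s t -> uabel_term s = uabel_term t.
Proof.
elim=> //=.
- by move=> ? ? ? _ -> _ ->.
- by move=> ? ? _ ->.
- by move=> ? ? ? ? _ -> _ ->.
- by move=> ? ? ? ? /uaug_ueq-> -> /uaug_ueq-> ->.
- by move=> *; rewrite addrA.
- by move=> *; rewrite addrC.
- by move=> *; rewrite add0r.
- by move=> *; rewrite addNr.
- move=> s' t' u; rewrite !mulrzDl !mulrzA addrA (mulrzAC _ _ (uabel_term t')).
  by rewrite (mulrzAC (uaug_term s') (uaug_term t') (uabel_term u)).
- by move=> s'; rewrite mul0rz addr0.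
- by move=> s'; rewrite mul0rz add0r.
- by move=> *; rewrite mulrzDr mulrzDl addrACA.
- by move=> *; rewrite mulrzDr mulrzDl addrACA.
- by move=> x y; rewrite raddfD.
- by move=> x y; rewrite lcs_pi1_bracket !mulr0z !addr0 subrr.
Qed.

Definition uabel (a : ug F) : lcs_quot F 1 := uabel_term (urepr a).

Lemma uabel_pi t : uabel (upi t) = uabel_term t.
Proof. exact/uabel_ueq/urepr_pi. Qed.

Lemma uabel_additive : zmod_morphism uabel.
Proof.
move=> a b; rewrite -[a]ureprK -[b]ureprK -[_ - _]/(uadd _ (uopp _)).
by rewrite uopp_pi uadd_pi !uabel_pi.
Qed.

HB.instance Definition _ :=
  GRing.isZmodMorphism.Build (ug F) (lcs_quot F 1) uabel uabel_additive.

Lemma uabelM a b : uabel (a * b) = uabel b *~ uaug a + uabel a *~ uaug b.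
Proof.
rewrite -[a]ureprK -[b]ureprK -[_ * _]/(umul _ _) umul_pi.
by rewrite !uabel_pi !uaug_pi.
Qed.

Lemma uabel_gen x : uabel (ugen x) = lcs_pi 1 x.
Proof. exact: uabel_pi. Qed.

End Abelianization.

Section EnvelopingGenerators.
Variable F : lieAlgType.

Lemma ugen_additive : zmod_morphism (@ugen F).
Proof.
have D x y : ugen (x + y) = ugen x + ugen y :> ug F.
  by rewrite -[RHS]/(uadd _ _) uadd_pi; exact/upi_eq/ueq_genD.
by move=> x y; apply: (addIr (ugen y)); rewrite -D !subrK.
Qed.

HB.instance Definition _ :=
  GRing.isZmodMorphism.Build F (ug F) (@ugen F) ugen_additive.

Lemma ugen_bracket x y :
  ugen (bracket x y) = ugen x * ugen y - ugen y * ugen x :> ug F.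
Proof.
rewrite -[RHS]/(uadd (umul _ _) (uopp (umul _ _))) !umul_pi uopp_pi uadd_pi.
exact/upi_eq/ueq_genB.
Qed.

Lemma uaug_gen (x : F) : uaug (ugen x) = 0.
Proof. exact: uaug_pi. Qed.

End EnvelopingGenerators.

Lemma umap_gen (F G : lieAlgType) (p : {lie F -> G}) x :
  umap p (ugen x) = ugen (p x).
Proof. exact: umap_pi. Qed.

Section Products.
Variable F : lieAlgType.
Implicit Types T : seq (ug F * ug F).

(** Finite families of pairs [(x, y)] stand for the tensors [\sum x (x) y]. *)
Definition pairs_mul T : ug F := \sum_(t <- T) t.1 * t.2.

Definition aug_pairs T := forall t, t \in T -> uaug t.1 = 0 /\ uaug t.2 = 0.

Definition opp_pairs T := [seq (- t.1, t.2) | t <- T].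

Lemma pairs_mul_cat T1 T2 : pairs_mul (T1 ++ T2) = pairs_mul T1 + pairs_mul T2.
Proof. exact: big_cat. Qed.

Lemma pairs_mul_opp T : pairs_mul (opp_pairs T) = - pairs_mul T.
Proof.
by rewrite /pairs_mul big_map -sumrN; apply: eq_bigr => t _; rewrite mulNr.
Qed.

Lemma aug_pairs_cat T1 T2 :
  aug_pairs T1 -> aug_pairs T2 -> aug_pairs (T1 ++ T2).
Proof. by move=> h1 h2 t; rewrite mem_cat => /orP[/h1|/h2]. Qed.

Lemma aug_pairs_opp T : aug_pairs T -> aug_pairs (opp_pairs T).
Proof.
by move=> h _ /mapP[t /h[h1 h2] ->]; rewrite /= raddfN /= h1 oppr0.
Qed.

Lemma lcs1_pairs_mul (x : F) :
  x \in lcs_pred F 1 -> exists T, aug_pairs T /\ ugen x = pairs_mul T.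
Proof.
move=> /lcs_predP; elim=> [{}x [u [v [_ ->]]]| |u v _ [T [hT eT]] _ [T' [hT' eT']]].
- exists [:: (ugen u, ugen v); (- ugen v, ugen u)]; split.
    by move=> t; rewrite !inE => /orP[]/eqP-> /=; rewrite ?raddfN /= !uaug_gen ?oppr0.
  by rewrite ugen_bracket /pairs_mul !big_cons big_nil addr0 mulNr.
- by exists [::]; rewrite raddf0 /pairs_mul big_nil.
- exists (T ++ opp_pairs T'); rewrite raddfB /= eT eT' pairs_mul_cat pairs_mul_opp.
  by split=> //; apply/aug_pairs_cat/aug_pairs_opp.
Qed.

(** The derivation [uabel] kills products of two elements of the augmentation ideal and sends
    [ugen x] to the class of [x] in [F / [F, F]]. *)
Lemma pairs_mul_lcs1 T (x : F) :
  aug_pairs T -> ugen x = pairs_mul T -> x \in lcs_pred F 1.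
Proof.
move=> hT eT; rewrite -[x]subr0; apply/lcs_pi_eq; rewrite raddf0 -uabel_gen eT.
rewrite /pairs_mul raddf_sum big_seq big1 // => t /hT[h1 h2].
by rewrite /= uabelM h1 h2 !mulr0z addr0.
Qed.

End Products.

Section EnvelopingKernel.
Variables (F G : lieAlgType) (p : {lie F -> G}).
Hypothesis p_surj : forall y : G, exists x : F, p x = y.

Definition ker_pair (t : ug F * ug F) :=
  [/\ uaug t.1 = 0, uaug t.2 = 0 & umap p t.1 = 0 \/ umap p t.2 = 0].

Inductive ker_gen : set (ug F) :=
| ker_gen_lie r : p r = 0 -> ker_gen (ugen r)
| ker_gen_mul t : ker_pair t -> ker_gen (t.1 * t.2).

Lemma aug_split (x : ug F) :
  exists2 y, uaug y = 0 & x = (uaug x)%:~R + y.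
Proof.
exists (x - (uaug x)%:~R); last by rewrite addrCA subrr addr0.
by rewrite raddfB /= rmorph_int intz subrr.
Qed.

(** Split [x] into an integer and an augmentation element [y]. Integer multiples stay in the span,
    and [y] times a generator of either kind is again a product of a [ker_pair]. *)
Lemma ker_gen_idealr x u : zspan ker_gen u -> zspan ker_gen (x * u).
Proof.
have [y y0 ->] := aug_split x.
elim=> [{}u| |v w _ hv _ hw]; last 2 first.
- by rewrite mulr0; exact: zspan_zero.
- by rewrite mulrBr; exact: zspan_sub.
move=> hu; rewrite mulrDl; apply/zspan_predP/rpredD.
  by rewrite mulrzl rpredMz //; apply/zspan_predP; exact: zspan_gen.
apply/zspan_predP/zspan_gen; case: hu => [r pr|[a b] [/= a0 b0 ab]].
  apply: (@ker_gen_mul (y, ugen r)); split=> //=; first exact: uaug_gen.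
  by right; rewrite umap_gen pr raddf0.
rewrite mulrA; apply: (@ker_gen_mul (y * a, b)); split=> //=.
  by rewrite rmorphM /= y0 mul0r.
by case: ab => h; [left; rewrite rmorphM /= h mulr0|right].
Qed.

Lemma ker_gen_ideall x u : zspan ker_gen u -> zspan ker_gen (u * x).
Proof.
have [y y0 ->] := aug_split x.
elim=> [{}u| |v w _ hv _ hw]; last 2 first.
- by rewrite mul0r; exact: zspan_zero.
- by rewrite mulrBl; exact: zspan_sub.
move=> hu; rewrite mulrDr; apply/zspan_predP/rpredD.
  by rewrite mulrzr rpredMz //; apply/zspan_predP; exact: zspan_gen.
apply/zspan_predP/zspan_gen; case: hu => [r pr|[a b] [/= a0 b0 ab]].
  apply: (@ker_gen_mul (ugen r, y)); split=> //=; first exact: uaug_gen.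
  by left; rewrite umap_gen pr raddf0.
rewrite -mulrA; apply: (@ker_gen_mul (a, b * y)); split=> //=.
  by rewrite rmorphM /= y0 mulr0.
by case: ab => h; [left|right; rewrite rmorphM /= h mul0r].
Qed.

Definition lie_section (y : G) : F := projT1 (cid (p_surj y)).

Lemma lie_sectionK y : p (lie_section y) = y.
Proof. by rewrite /lie_section; case: cid. Qed.

(** A set-theoretic section of [p] extends to terms; modulo the ideal spanned
    by [ker_gen] it descends to an inverse of [ug F -> ug G]. *)
Fixpoint ulift (t : uterm G) : ug F :=
  match t with
  | UGen y => ugen (lie_section y)
  | UZero => 0
  | UOne => 1
  | UOpp s => - ulift s
  | UAdd s u => ulift s + ulift u
  | UMul s u => ulift s * ulift u
  end.

Local Notation J := (zspan_pred ker_gen).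

Lemma ker_gen_ugen x y : p x = p y -> ugen x - ugen y \in J.
Proof.
move=> e; rewrite -raddfB; apply/zspan_predP/zspan_gen/ker_gen_lie.
by rewrite raddfB /= e subrr.
Qed.

Lemma ker_gen_mulB a a' b b' : a - a' \in J -> b - b' \in J -> a * b - a' * b' \in J.
Proof.
move=> /zspan_predP ha /zspan_predP hb.
have -> : a * b - a' * b' = (a - a') * b + a' * (b - b').
  by rewrite mulrBl mulrBr addrA subrK.
by apply: rpredD; apply/zspan_predP; [exact: ker_gen_ideall|exact: ker_gen_idealr].
Qed.

(** The ring axioms hold exactly in [ug F]; the failure of the section to respect sums and brackets
    is [ugen] of an element of [ker p]. *)
Lemma ulift_ueq s t : ueq s t -> ulift s - ulift t \in J.
Proof.
have eqJ a b : a = b -> a - b \in J by move=> ->; rewrite subrr rpred0.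
elim=> /=.
- by move=> *; exact: eqJ.
- by move=> s' t' _ h; rewrite -opprB rpredN.
- by move=> s' t' u _ h1 _ h2; rewrite -(subrKA (ulift t')) rpredD.
- by move=> s' t' _ h; rewrite -opprD rpredN.
- by move=> ? ? ? ? _ h1 _ h2; rewrite opprD addrACA rpredD.
- by move=> ? ? ? ? _ h1 _ h2; exact: ker_gen_mulB.
- by move=> *; apply: eqJ; rewrite addrA.
- by move=> *; apply: eqJ; rewrite addrC.
- by move=> *; apply: eqJ; rewrite add0r.
- by move=> *; apply: eqJ; rewrite addNr.
- by move=> *; apply: eqJ; rewrite mulrA.
- by move=> *; apply: eqJ; rewrite mul1r.
- by move=> *; apply: eqJ; rewrite mulr1.
- by move=> *; apply: eqJ; rewrite mulrDl.
- by move=> *; apply: eqJ; rewrite mulrDr.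
- move=> x y; rewrite -raddfD; apply: ker_gen_ugen.
  by rewrite raddfD /= !lie_sectionK.
- move=> x y; rewrite -ugen_bracket; apply: ker_gen_ugen.
  by rewrite lie_morph !lie_sectionK.
Qed.

Lemma ulift_umap (t : uterm F) : ulift (umap_term p t) - upi t \in J.
Proof.
elim: t => [x| | |s hs|s hs t ht|s hs t ht] /=.
- by apply: ker_gen_ugen; rewrite lie_sectionK.
- by rewrite subrr rpred0.
- by rewrite subrr rpred0.
- by rewrite -uopp_pi -[uopp _]/(- upi s) -opprD rpredN.
- by rewrite -uadd_pi -[uadd _ _]/(upi s + upi t) opprD addrACA rpredD.
- by rewrite -umul_pi -[umul _ _]/(upi s * upi t) ker_gen_mulB.
Qed.

Lemma umap_surj (a : ug G) : exists b, umap p b = a.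
Proof.
rewrite -[a]ureprK; elim: (urepr a) => [y| | |s [b hb]|s [b hb] t [c hc]|s [b hb] t [c hc]].
- by have [x <-] := p_surj y; exists (ugen x); exact: umap_gen.
- by exists 0; rewrite raddf0.
- by exists 1; rewrite rmorph1.
- by exists (- b); rewrite raddfN /= hb -[LHS]/(uopp _) uopp_pi.
- by exists (b + c); rewrite raddfD /= hb hc -[LHS]/(uadd _ _) uadd_pi.
- by exists (b * c); rewrite rmorphM /= hb hc -[LHS]/(umul _ _) umul_pi.
Qed.

(** The kernel [J] of [ug F -> ug G] is [ker p + I J + J I], where [I] is the
    augmentation ideal. *)
Lemma umap_ker (u : ug F) : umap p u = 0 ->
  exists r T, [/\ p r = 0, forall t, t \in T -> ker_pair t & u = ugen r + pairs_mul T].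
Proof.
move=> pu; suff : zspan ker_gen u.
  elim=> [_ [r pr|t ht]| |v w _ [r [T [pr hT ->]]] _ [r' [T' [pr' hT' ->]]]].
  - by exists r, [::]; rewrite /pairs_mul big_nil addr0.
  - exists 0, [:: t]; rewrite !raddf0 add0r /pairs_mul big_seq1; split=> //.
    by move=> s; rewrite inE => /eqP->.
  - by exists 0, [::]; rewrite !raddf0 /pairs_mul big_nil addr0.
  - exists (r - r'), (T ++ opp_pairs T'); rewrite !raddfB /= pr pr' subrr.
    rewrite pairs_mul_cat pairs_mul_opp.
    split=> //; last by rewrite opprD addrACA.
    move=> t; rewrite mem_cat => /orP[/hT//|/mapP[s /hT'[s1 s2 s12] ->]].
    split; rewrite /= ?raddfN /= ?s1 ?oppr0 //.
    by case: s12 => ->; [left; rewrite oppr0|right].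
apply/zspan_predP; rewrite -[u]ureprK in pu *.
(* The lift of the image of [u] is congruent to [0], since that image vanishes, and also to [u]
   itself. *)
have /upi_eq/ulift_ueq/= : upi (umap_term p (urepr u)) = upi (UZero G).
  by rewrite -umap_pi pu.
rewrite subr0 => h.
by have := rpredB h (ulift_umap (urepr u)); rewrite opprB addrC subrK.
Qed.

End EnvelopingKernel.

(** * Tor over an enveloping algebra *)

Section Coinvariants.
Variables (g : lieAlgType) (N : lmodType (ug g)).
Implicit Types v w : N.

Let one : trivr g := 1%Z.

Definition tensor1 : N -> tensor (trivr g) N :=
  locked (fun v => \pi_(tensor (trivr g) N) (tgen one v)).

Lemma tensor1E v : tensor1 v = \pi_(tensor (trivr g) N) (tgen one v).
Proof. by rewrite /tensor1 -lock. Qed.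

(** The submodule [I N]; it turns out to be the kernel of [tensor1], so that the trivial module
    tensored with [N] is [N / I N]. *)
Definition augmul : set N := zspan (fun v => exists x u, uaug x = 0 /\ v = x *: u).

Lemma augmulZ x v : uaug x = 0 -> augmul (x *: v).
Proof. by move=> x0; rewrite /augmul; constructor; exists x, v. Qed.

Lemma augmulB v w : augmul v -> augmul w -> augmul (v - w).
Proof. exact: zspan_sub. Qed.

Lemma tensor_pi_eq (a b : tensor_free (trivr g) N) :
  a - b \in zspan_pred (@tensor_rel _ (trivr g) N) ->
  \pi_(tensor (trivr g) N) a = \pi_(tensor (trivr g) N) b.
Proof. by rewrite Quotient.idealrBE => /eqP. Qed.

Lemma tensor1_additive : zmod_morphism tensor1.
Proof.
have D v w : tensor1 (v + w) = tensor1 v + tensor1 w.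
  rewrite !tensor1E -raddfD; apply: tensor_pi_eq; rewrite opprD addrA.
  by apply/zspan_predP/zspan_gen; exact: tensor_addr.
by move=> v w; have := D (v - w) w; rewrite subrK => ->; rewrite addrK.
Qed.

HB.instance Definition _ :=
  GRing.isZmodMorphism.Build N (tensor (trivr g) N) tensor1 tensor1_additive.

Lemma tensor1_scale (m : int) v :
  \pi_(tensor (trivr g) N) (tgen (m : trivr g) v) = tensor1 v *~ m.
Proof.
pose c (m : int) : tensor (trivr g) N := \pi_(tensor (trivr g) N) (tgen (m : trivr g) v).
have D : {morph c : a b / a + b}.
  move=> a b; rewrite /c -raddfD; apply: tensor_pi_eq; rewrite opprD addrA.
  by apply/zspan_predP/zspan_gen; exact: tensor_addl.
have B : zmod_morphism c by move=> a b; have := D (a - b) b; rewrite subrK => ->; rewrite addrK.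
pose C : {additive int -> tensor (trivr g) N} := HB.pack_for
  {additive int -> tensor (trivr g) N} c (GRing.isZmodMorphism.Build _ _ _ B).
by rewrite -[LHS]/(C m) -[m in LHS]intz raddfMz tensor1E.
Qed.

Lemma tensor1Z (x : ug g) v : tensor1 (x *: v) = tensor1 v *~ uaug x.
Proof.
rewrite -tensor1_scale tensor1E; apply/esym; apply: tensor_pi_eq.
apply/zspan_predP/zspan_gen.
have -> : uaug x = (x : (ug g)^c) *: one.
  by rewrite -[RHS]/(1 * uaug x) mul1r.
exact: tensor_bal.
Qed.

Lemma tensor1_surj a : exists v, a = tensor1 v.
Proof.
rewrite -[a]reprK; move: (repr a) => u; rewrite [u]monalgE raddf_sum.
elim/big_ind: _ => [|_ _ [v ->] [w ->]|[m n] _].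
- by exists 0; rewrite raddf0.
- by exists (v + w); rewrite raddfD.
- exists (n *~ (u@_(m, n) * m)).
  have -> : << u@_(m, n) *g (m, n) >> = tgen m n *~ u@_(m, n).
    by rewrite /tgen -raddfMz /= intz.
  by rewrite !raddfMz /= (tensor1_scale m) -mulrzA mulrC.
Qed.

Lemma augmul_tensor1 v : augmul v -> tensor1 v = 0.
Proof.
elim=> [_ [x [u [x0 ->]]]| |a b _ ha _ hb].
- by rewrite tensor1Z x0 mulr0z.
- exact: raddf0.
- by rewrite raddfB /= ha hb subrr.
Qed.

(** Evaluate formal tensors in [N] by [tgen m n -> n *~ m]. Additivity relations go to [0] and
    balancing relations into [I N]. *)
Lemma tensor1_augmul v : tensor1 v = 0 -> augmul v.
Proof.
rewrite tensor1E => /quot_pi_eq0/zspan_predP h.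
have [ev evU] : exists ev : {additive tensor_free (trivr g) N -> zmodule N},
    forall m n, ev (tgen m n) = n *~ m.
  pose ev : {additive tensor_free (trivr g) N -> zmodule N} :=
    linext (fun p : (trivr g * N)%type => p.2 *~ p.1 : zmodule N).
  by exists ev => m n; rewrite [LHS]linextU scale1r.
have evB a b : ev (a - b) = ev a - ev b :> N by exact: raddfB.
have evB2 a b c : ev (a - b - c) = ev a - ev b - ev c :> N by rewrite 2!evB.
have ev0 : ev 0 = 0 :> N by exact: raddf0.
have -> : v = ev (tgen one v) by rewrite evU.
apply/zspan_predP; move: (tgen _ _) h => t; elim=> [{}t ht| |a b _ ha _ hb].
- case: ht => [m m' n|m n n'|x m n]; move: (@tgen _ (trivr g) N) evU => tg evU.
  + by rewrite evB2 !evU mulrzDr -addrA -opprD subrr rpred0.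
  + by rewrite evB2 !evU mulrzDl -addrA -opprD subrr rpred0.
  + rewrite evB !evU.
    (* The integer part of [x] contributes equally to both sides, so only its augmentation part [y]
       remains. *)
    have [y y0 ex] := aug_split x; apply/zspan_predP/zspan_gen.
    exists (- y), (n *~ m); split; first by rewrite raddfN /= y0 oppr0.
    rewrite -[(x : (ug g)^c) *: m]/(m * uaug x) [in x *: n]ex scalerDl.
    rewrite mulrzDl scaler_int mulrC mulrzA opprD addrA subrr add0r scaleNr.
    by congr (- _); rewrite raddfMz.
- by rewrite ev0 rpred0.
- by rewrite evB rpredB.
Qed.

End Coinvariants.

(** * Dimension shifting in the standard resolution *)

Section ResolutionClasses.
Variables (g : lieAlgType) (s : arrow (ug g)).

Definition tcycles := zker (tensor_diff (trivr g) (next_arrow s)).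

(** For [s = resol N n] this is [Tor] in degree [n.+1]. *)
Definition cycles_homology : zmodType :=
  @homol (tensor (trivr g) (src (next_arrow (next_arrow s))))
    (tensor (trivr g) (src (next_arrow s))) (tensor (trivr g) (src s))
    (tensor_diff (trivr g) (next_arrow (next_arrow s)))
    (tensor_diff (trivr g) (next_arrow s)).

Lemma tensor_diff_tensor1 (t : arrow (ug g)) v :
  tensor_diff (trivr g) t (tensor1 v) = tensor1 (diff t v).
Proof.
rewrite !tensor1E [LHS]tensor_map_pi; congr (\pi_(_) _).
exact: tensor_free_mapU.
Qed.

Definition tcycle : src s -> tcycles := locked (fun z => insubd 0 (tensor1 (kgen z))).

(** Dimension shift: with [Z] the kernel of [diff s] and [F] its source, [hclass] is meant for [z]
    in both [Z] and [I F]. It is additive there, hits every class and vanishes on [I Z]. *)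
Definition hclass (z : src s) : cycles_homology := \pi_cycles_homology (tcycle z).

Lemma tcycleK z : diff s z = 0 -> augmul z ->
  val (tcycle z) = tensor1 (kgen z).
Proof.
move=> dz az; rewrite /tcycle -lock insubdK // inE tensor_diff_tensor1 diff_kgen //.
by rewrite augmul_tensor1.
Qed.

(** A cycle [u] is the boundary of [kgen u], so its tensor is a boundary too. *)
Lemma hclass_tensor1 (k : tcycles) u : val k = tensor1 (u : src (next_arrow s)) ->
  diff (next_arrow s) u = 0 -> \pi_cycles_homology k = 0.
Proof.
move=> ek hu; apply/quot_pi_eq0/asboolP.
exists (tensor1 (kgen u)).
by rewrite tensor_diff_tensor1 diff_kgen // ek.
Qed.

Lemma hclass_eq (k k' : tcycles) u v : val k = tensor1 (u : src (next_arrow s)) ->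
  val k' = tensor1 v -> diff (next_arrow s) u = diff (next_arrow s) v ->
  \pi_cycles_homology k = \pi_cycles_homology k'.
Proof.
move=> ek ek' uv; apply/eqP; rewrite -subr_eq0 -raddfB; apply/eqP.
apply: (@hclass_tensor1 _ (u - v)); last by rewrite diffB uv subrr.
by rewrite raddfB /= ek ek' [RHS]raddfB.
Qed.

(** Represent the class by [tensor1 u] and take for [z] the boundary of [u]: the cycle condition on
    [tensor1 u] says that [z] lies in the augmentation part, and [u] and [kgen z] have the same
    boundary. *)
Lemma hclass_surj (c : cycles_homology) :
  exists z, [/\ diff s z = 0, augmul z & c = hclass z].
Proof.
rewrite -[c]reprK; move: (repr c) => k.
have [u eu] := tensor1_surj (val k).
exists (diff (next_arrow s) u); have dd := diff_next u.
have au : augmul (diff (next_arrow s) u).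
  by apply: tensor1_augmul; rewrite -tensor_diff_tensor1 -eu zkerP.
split=> //; apply: hclass_eq eu (tcycleK dd au) _.
by rewrite diff_kgen.
Qed.

Lemma hclassB z z' : diff s z = 0 -> diff s z' = 0 -> augmul z -> augmul z' ->
  hclass (z - z') = hclass z - hclass z'.
Proof.
move=> dz dz' az az'; rewrite /hclass -raddfB.
have dB : diff s (z - z') = 0 by rewrite diffB dz dz' subrr.
have aB : augmul (z - z') by exact: augmulB.
have e : val (tcycle z - tcycle z') =
    tensor1 (kgen z - kgen z').
  by rewrite raddfB /= !tcycleK // [RHS]raddfB.
apply: hclass_eq (tcycleK dB aB) e _.
by rewrite diffB !diff_kgen.
Qed.

(** Such a [z] also lifts to a combination of terms [x *: kgen u], which dies in the tensor product
    and differs from [kgen z] by a cycle. *)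
Lemma hclass_aug_cycles z :
  zspan (fun v => exists x u, [/\ uaug x = 0, diff s u = 0 & v = x *: u]) z ->
  hclass z = 0.
Proof.
move=> hz.
have [u au du] : exists2 u : src (next_arrow s), augmul u & diff (next_arrow s) u = z.
  elim: hz => [{}z [x [u [x0 du ->]]]| |a b _ [u au du] _ [v av dv]].
  - exists (x *: kgen u); first exact: augmulZ.
    by rewrite linearZ /= diff_kgen.
  - by exists 0; [exact: zspan_zero|rewrite raddf0].
  - by exists (u - v); [exact: augmulB|rewrite diffB du dv].
have dz : diff s z = 0 by rewrite -du; exact: diff_next.
have az : augmul z.
  elim: hz {u au du dz} => [{}z [x [u [x0 du ->]]]| |a b _ ha _ hb].
  - exact: augmulZ.
  - exact: zspan_zero.
  - exact: augmulB.
apply: (@hclass_tensor1 _ (kgen z - u)).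
  by rewrite tcycleK // raddfB /= (augmul_tensor1 au) subr0.
by rewrite diffB diff_kgen // du subrr.
Qed.

End ResolutionClasses.

Lemma homol_map_pi (A B C A' B' C' : zmodType)
    (f : {additive A -> B}) (g : {additive B -> C})
    (f' : {additive A' -> B'}) (g' : {additive B' -> C'})
    (a : {additive A -> A'}) (b : {additive B -> B'}) (c : {additive C -> C'})
    (bf : forall x, b (f x) = f' (a x)) (cg : forall x, c (g x) = g' (b x)) x :
  homol_map bf cg (\pi_(homol f g) x) = \pi_(homol f' g') (zker_map cg x).
Proof. exact: (quot_map_pi (zker_map_im bf cg)). Qed.

Section ClassNaturality.
Variables (g h : lieAlgType) (f : {lie g -> h}).
Variables (s : arrow (ug g)) (t : arrow (ug h)) (m : arrow_map (umap f) s t).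

Let aZ := trivr_map_scalable f.

Lemma map_src_augmul z : augmul z -> augmul (map_src m z).
Proof.
elim=> [_ [x [u [x0 ->]]]| |a b _ ha _ hb].
- by rewrite linearZ /=; apply: augmulZ; rewrite uaug_umap.
- by rewrite raddf0; exact: zspan_zero.
- by rewrite raddfB; exact: augmulB.
Qed.

Lemma map_src_cycle z : diff s z = 0 -> diff t (map_src m z) = 0.
Proof. by move=> dz; rewrite -map_diff dz raddf0. Qed.

Lemma map_src_kgen z : diff s z = 0 ->
  map_src (Defs.next_map m) (kgen z) = kgen (map_src m z).
Proof.
move=> dz; rewrite !kgenE [LHS]lextU rmorph1 scale1r; congr << _ >>.
by apply: val_inj; rewrite /= cycK // cycK //; exact: map_src_cycle.
Qed.

Lemma tensor_map_src_tensor1 z :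
  tensor_map_src aZ (Defs.next_map m) (tensor1 z) = tensor1 (map_src (Defs.next_map m) z).
Proof.
rewrite !tensor1E [LHS]tensor_map_pi; congr (\pi_(_) _).
exact: tensor_free_mapU.
Qed.

(** Stated for arbitrary proofs [bf] and [cg] of commutativity, so as to apply to those inside
    [Tor_map]. *)
Lemma homol_map_hclass
    (bf : forall x, tensor_map_src aZ (Defs.next_map m)
       (tensor_diff (trivr g) (next_arrow (next_arrow s)) x) =
       tensor_diff (trivr h) (next_arrow (next_arrow t))
         (tensor_map_src aZ (Defs.next_map (Defs.next_map m)) x))
    (cg : forall x, tensor_map_tgt aZ (Defs.next_map m)
       (tensor_diff (trivr g) (next_arrow s) x) =
       tensor_diff (trivr h) (next_arrow t) (tensor_map_src aZ (Defs.next_map m) x)) z :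
  diff s z = 0 -> augmul z ->
  homol_map bf cg (hclass z) = hclass (map_src m z).
Proof.
move=> dz az; rewrite /hclass [LHS]homol_map_pi; congr (\pi_(_) _).
apply: val_inj; rewrite (tcycleK (map_src_cycle dz) (map_src_augmul az)).
rewrite -[LHS]/(tensor_map_src aZ (Defs.next_map m) (val (tcycle z))) (tcycleK dz az).
by rewrite tensor_map_src_tensor1 map_src_kgen.
Qed.

End ClassNaturality.

Lemma malg_ind (R : nzRingType) (X : choiceType) (P : {malg R[X]} -> Prop) :
  P 0 -> (forall u v, P u -> P v -> P (u + v)) ->
  (forall c x, P (c *: << x >>)) -> forall u, P u.
Proof.
move=> P0 PD PU u; rewrite [u]monalgE; elim/big_ind: _ => // x _.
have -> // : << u@_x *g x >> = u@_x *: << x >> :> {malg R[X]}.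
apply/malgP => y; rewrite mcoeffZ !mcoeffU.
by case: eqP; rewrite ?mulr1 ?mulr0.
Qed.

Section LowDegree.
Variable g : lieAlgType.

Local Notation s0 := (resol (trivl g) 0).
Local Notation s1 := (resol (trivl g) 1).

Definition gen1 : src s0 := << (1%Z : trivl g) >>.

Lemma diff_gen1 y : diff s0 (y *: gen1) = (uaug y : trivl g).
Proof. by rewrite linearZ /= linextU scale1r -[LHS]/(uaug y * 1) mulr1. Qed.

Lemma diff_gen1_aug y : uaug y = 0 -> diff s0 (y *: gen1) = 0.
Proof. by rewrite diff_gen1. Qed.

(** [F_0] is free on the underlying set of [Z]; up to the homotopy [h] the
    resolution retracts onto the copy of [ug g] generated by [1]. *)
Lemma contraction : exists (q : src s0 -> ug g) (h : {linear src s0 -> src s1}),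
  [/\ forall y, q (y *: gen1) = y,
      forall v, diff s0 v = 0 -> uaug (q v) = 0 &
      forall v, diff s1 (h v) = v - q v *: gen1].
Proof.
pose q : {linear {malg (ug g)[trivl g]} -> (ug g)^o} :=
  linext (fun n : trivl g => (n : int)%:~R : (ug g)^o).
have qU n : q << n >> = (n : int)%:~R by rewrite [LHS]linextU scale1r.
(* Both [<< n >>] and [n] times [gen1] augment to [n]; their difference is a cycle, and its
   generator provides the homotopy. *)
pose h : {linear {malg (ug g)[trivl g]} -> src s1} :=
  linext (fun n : trivl g => kgen ((<< n >> : src s0) - (n : int)%:~R *: gen1)).
have hU n : h << n >> = kgen ((<< n >> : src s0) - (n : int)%:~R *: gen1).
  by rewrite [LHS]linextU scale1r.
exists q, h; split.
- by move=> y; rewrite linearZ /= qU -[LHS]/(y * 1) mulr1.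
- move=> v dv; suff -> : uaug (q v) = diff s0 v :> int by [].
  move: v {dv}; apply: malg_ind => [|u v hu hv|c n].
  + by rewrite !raddf0.
  + by rewrite !raddfD /= hu hv.
  + rewrite [q _]linearZ_LR qU [RHS]linearZ_LR.
    rewrite -[LHS]/(uaug (c * (n : int)%:~R)) rmorphM /= rmorph_int intz.
    by have -> : diff s0 << n >> = n by rewrite [LHS]linextU scale1r.
- apply: malg_ind => [|u v hu hv|c n].
  + by rewrite !raddf0 scale0r subr0.
  + rewrite [h _]raddfD [LHS]raddfD [q _]raddfD scalerDl opprD addrACA.
    by rewrite [X in X + _]hu [X in _ + X]hv.
  + rewrite [h _]linearZ_LR hU [q _]linearZ_LR qU [LHS]linearZ_LR diff_kgen.
      by rewrite scalerBr scalerA.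
    by rewrite diffB diff_gen1 [X in X - _]linextU scale1r rmorph_int intz subrr.
Qed.

End LowDegree.

Section PairClasses.
Variables (g : lieAlgType) (s : arrow (ug g)) (e : src s).
Hypothesis diff_e0 : forall y, uaug y = 0 -> diff s (y *: e) = 0.
Implicit Types T : seq (ug g * ug g).

Definition pairs_chain T : src (next_arrow s) := \sum_(t <- T) t.1 *: kgen (t.2 *: e).

(** Every class has a representative [1 (x) << z >>] with [z] in [I F_1] a cycle;
    [theta] sends a family of pairs [(x, y)] with [\sum x y = 0] to the class of
    [z = \sum x << y e >>]. *)
Definition theta : seq (ug g * ug g) -> cycles_homology (next_arrow s) :=
  locked (fun T => hclass (pairs_chain T)).

Lemma thetaE T : theta T = hclass (pairs_chain T).
Proof. by rewrite /theta -lock. Qed.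

Lemma pairs_chain1 x y : pairs_chain [:: (x, y)] = x *: kgen (y *: e).
Proof. exact: big_seq1. Qed.

Lemma pairs_chain_sub T T' :
  pairs_chain (T ++ opp_pairs T') = pairs_chain T - pairs_chain T'.
Proof.
rewrite /pairs_chain big_cat big_map -sumrN; congr (_ + _).
by apply: eq_bigr => t _; rewrite scaleNr.
Qed.

Lemma pairs_chain_aug T : aug_pairs T -> augmul (pairs_chain T).
Proof.
move=> aT; rewrite /pairs_chain big_seq.
apply/zspan_predP; apply: rpred_sum => t /aT[t0 _]; apply/zspan_predP.
exact: augmulZ.
Qed.

Lemma diff_pairs_chain T : aug_pairs T -> diff (next_arrow s) (pairs_chain T) = pairs_mul T *: e.
Proof.
move=> aT; rewrite /pairs_chain /pairs_mul raddf_sum scaler_suml.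
apply: eq_big_seq => t /aT[_ t0].
by rewrite [LHS]linearZ_LR diff_kgen ?scalerA //; exact: diff_e0.
Qed.

Lemma pairs_chain_cycle T : aug_pairs T -> pairs_mul T = 0 -> diff (next_arrow s) (pairs_chain T) = 0.
Proof. by move=> aT mT; rewrite diff_pairs_chain // mT scale0r. Qed.

Lemma theta_sub T T' : aug_pairs T -> aug_pairs T' -> pairs_mul T = 0 -> pairs_mul T' = 0 ->
  theta (T ++ opp_pairs T') = theta T - theta T'.
Proof.
move=> aT aT' mT mT'; rewrite !thetaE.
have <- := hclassB (pairs_chain_cycle aT mT) (pairs_chain_cycle aT' mT')
  (pairs_chain_aug aT) (pairs_chain_aug aT').
by rewrite pairs_chain_sub.
Qed.

Local Notation aug_cycles :=
  (zspan (fun v : src (next_arrow s) => exists x u, [/\ uaug x = 0, diff (next_arrow s) u = 0 & v = x *: u])).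

(** When [y = 0], the element [kgen (y *: e)] is itself a cycle, so every summand is an augmentation
    element times a cycle. *)
Lemma theta_degenerate T : aug_pairs T ->
  (forall t, t \in T -> t.1 = 0 \/ t.2 = 0) -> theta T = 0.
Proof.
move=> aT T0; rewrite thetaE; apply: hclass_aug_cycles.
rewrite /pairs_chain big_seq; apply/zspan_predP; apply: rpred_sum => t tT.
have [t10 t20] := aT _ tT; apply/zspan_predP; apply: zspan_gen.
have [->|t2] := T0 _ tT.
  by exists 0, 0; split; rewrite ?raddf0 ?scale0r.
exists t.1, (kgen (t.2 *: e)); split=> //.
by rewrite diff_kgen ?t2 ?scale0r // raddf0.
Qed.

Lemma theta_surj (q : src s -> ug g) (h : {linear src s -> src (next_arrow s)})
    (c : cycles_homology (next_arrow s)) :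
  (forall y, q (y *: e) = y) -> (forall v, diff s v = 0 -> uaug (q v) = 0) ->
  (forall v, diff (next_arrow s) (h v) = v - q v *: e) ->
  exists T, [/\ aug_pairs T, pairs_mul T = 0 & c = theta T].
Proof.
move=> q1 q0 dh; have [z [dz az ->]] := hclass_surj c.
(* Modulo cycles and the image of the homotopy, a generator over [k] may be replaced by the one over
   its retraction [q k *: e]. *)
have split_chain (u : src (next_arrow s)) : exists T w,
    [/\ forall t, t \in T -> uaug t.2 = 0, diff (next_arrow s) w = 0 &
        u = pairs_chain T + h (diff (next_arrow s) u) + w].
  move: u; apply: malg_ind => [|u v [T [w [aT dw eu]]]
      [T' [w' [aT' dw' ev]]]|x k].
  - exists [::], 0; split; [by []|exact: raddf0|].
    by rewrite /pairs_chain big_nil !raddf0 !addr0.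
  - exists (T ++ T'), (w + w'); split.
    + by move=> t; rewrite mem_cat => /orP[/aT|/aT'].
    + by rewrite raddfD /= dw dw' addr0.
    + rewrite {1}eu {1}ev /pairs_chain big_cat raddfD /= [h (_ + _)]raddfD /=.
      by rewrite addrACA; congr (_ + _); rewrite addrACA.
  - have dk : diff s (val k) = 0 := eqP (valP k).
    have -> : << k >> = kgen (val k) :> src (next_arrow s).
      by rewrite kgenE; congr << _ >>; apply: val_inj; rewrite cycK.
    exists [:: (x, q (val k))].
    exists (x *: (kgen (val k) - kgen (q (val k) *: e) - h (val k))); split.
    + by move=> t; rewrite mem_seq1 => /eqP -> /=; exact: q0.
    + have dq : diff s (q (val k) *: e) = 0 by exact/diff_e0/q0.
      rewrite [LHS]linearZ_LR !diffB dh !diff_kgen //.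
      by rewrite subrr scaler0.
    + rewrite pairs_chain1 [diff _ (_ *: _)]linearZ_LR diff_kgen //.
      rewrite [h _]linearZ_LR -!scalerDr; congr (_ *: _).
      by rewrite -[_ - _ - _]addrA -opprD [RHS]addrC subrK.
(* Multiplying these decompositions by augmentation elements puts the first components of the pairs
   in the augmentation ideal and the cycle part in [aug_cycles]. As [z] is a cycle, the term in [h]
   then disappears. *)
have [T [w [aT hw ez]]] : exists T w, [/\ aug_pairs T, aug_cycles w &
    z = pairs_chain T + h (diff (next_arrow s) z) + w].
  elim: az {dz} => [{}z [x [u [x0 ->]]]| |u v _ [T [w [aT hw eu]]] _ [T' [w' [aT' hw' ev]]]].
  - have [T [w [aT dw eu]]] := split_chain u.
    exists [seq (x * t.1, t.2) | t <- T], (x *: w); split.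
    + move=> _ /mapP[t /aT t0 ->] /=; split=> //.
      by rewrite rmorphM /= x0 mul0r.
    + by apply: zspan_gen; exists x, w.
    + rewrite [diff _ _]linearZ_LR [h _]linearZ_LR {1}eu !scalerDr.
      congr (_ + _ + _); rewrite /pairs_chain big_map scaler_sumr.
      by apply: eq_bigr => t _; rewrite scalerA.
  - exists [::], 0; split=> //; first exact: zspan_zero.
    by rewrite /pairs_chain big_nil !raddf0 !addr0.
  - exists (T ++ opp_pairs T'), (w - w'); split.
    + exact/aug_pairs_cat/aug_pairs_opp.
    + exact: zspan_sub.
    + rewrite {1}eu {1}ev pairs_chain_sub diffB [h (_ - _)]raddfB !opprD addrACA.
      by rewrite [X in X + _ = _]addrACA.
have dw : diff (next_arrow s) w = 0.
  elim: hw {ez} => [{}w [x [u [_ du ->]]]| |u v _ hu _ hv].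
  - by rewrite [LHS]linearZ_LR du scaler0.
  - by rewrite raddf0.
  - by rewrite diffB hu hv subrr.
rewrite dz raddf0 addr0 in ez.
have mT : pairs_mul T = 0.
  rewrite -[pairs_mul T]q1 -diff_pairs_chain //.
  have -> : diff (next_arrow s) (pairs_chain T) = 0.
    by rewrite -(addrK w (pairs_chain T)) -ez diffB dz dw subrr.
  by rewrite -(scale0r e) q1.
exists T; split=> //; rewrite thetaE.
have cT := pairs_chain_cycle aT mT; have gT := pairs_chain_aug aT.
apply/eqP; rewrite -subr_eq0; apply/eqP.
have <- := hclassB dz cT az gT.
by apply: hclass_aug_cycles; rewrite ez addrC addKr.
Qed.

End PairClasses.

Definition map_pairs (g h : lieAlgType) (f : {lie g -> h}) (T : seq (ug g * ug g)) :=
  [seq (umap f t.1, umap f t.2) | t <- T].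

(** Otherwise the identification of [Tor _ _ n.+1] with [cycles_homology] unfolds
    both sides down to the underlying quotients. *)
Strategy 1000 [homol].

Definition lie_theta (g : lieAlgType) (T : seq (ug g * ug g)) : lie_homology g 2 :=
  theta (gen1 g) T.

Section LieTheta.
Variable g : lieAlgType.
Implicit Types T : seq (ug g * ug g).

Lemma lie_theta_sub T T' : aug_pairs T -> aug_pairs T' -> pairs_mul T = 0 -> pairs_mul T' = 0 ->
  lie_theta (T ++ opp_pairs T') = lie_theta T - lie_theta T'.
Proof. exact: (theta_sub (@diff_gen1_aug g)). Qed.

Lemma lie_theta_degenerate T : aug_pairs T ->
  (forall t, t \in T -> t.1 = 0 \/ t.2 = 0) -> lie_theta T = 0.
Proof. exact: theta_degenerate. Qed.

Lemma lie_theta_surj (c : lie_homology g 2) :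
  exists T, [/\ aug_pairs T, pairs_mul T = 0 & c = lie_theta T].
Proof.
have [q [h [q1 q0 dh]]] := contraction g.
exact: (theta_surj (@diff_gen1_aug g) c q1 q0 dh).
Qed.

(** The map of resolutions sends [gen1] to [gen1] and [kgen] of a cycle to [kgen] of its image. *)
Lemma lie_theta_map (h : lieAlgType) (f : {lie g -> h}) T :
  aug_pairs T -> pairs_mul T = 0 ->
  lie_homology_map f 2 (lie_theta T) = lie_theta (map_pairs f T).
Proof.
move=> aT mT; rewrite /lie_theta !thetaE.
pose m0 := resol_map (trivl_map h : {linear trivl g -> trivl h | umap f \; *:%R}) 0.
transitivity (hclass (map_src (Defs.next_map m0) (pairs_chain (gen1 g) T))
   : lie_homology h 2).
  apply: homol_map_hclass; last exact: pairs_chain_aug.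
  exact: (pairs_chain_cycle (@diff_gen1_aug g)).
congr (hclass _).
have kM y : map_src m0 (y *: gen1 g) = umap f y *: gen1 h.
  have kk : map_src m0 (gen1 g) = gen1 h by rewrite [LHS]lextU rmorph1 scale1r.
  by rewrite [LHS]linearZ_LR kk.
rewrite /pairs_chain raddf_sum big_map; apply: eq_big_seq => t /aT[_ t0].
rewrite [LHS]linearZ_LR map_src_kgen ?kM //; exact: diff_gen1_aug.
Qed.

End LieTheta.

(** * Hopf's formula *)

Lemma umap_square (F G F' G' : lieAlgType) (p : {lie F -> G}) (p' : {lie F' -> G'})
    (u : {lie F -> F'}) (v : {lie G -> G'}) :
  (forall x, p' (u x) = v (p x)) ->
  forall a, umap p' (umap u a) = umap v (umap p a).
Proof.
move=> sq a; rewrite -[a]ureprK !umap_pi; congr upi.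
by elim: (urepr a) => //= [x|t ->|t -> s ->|t -> s ->] //; rewrite sq.
Qed.

Section MapPairs.
Variables (F G : lieAlgType) (p : {lie F -> G}).
Implicit Types T : seq (ug F * ug F).

Lemma aug_pairs_map T : aug_pairs T -> aug_pairs (map_pairs p T).
Proof. by move=> aT _ /mapP[t /aT[h1 h2] ->]; rewrite /= !uaug_umap. Qed.

Lemma pairs_mul_map T : pairs_mul (map_pairs p T) = umap p (pairs_mul T).
Proof.
rewrite /pairs_mul big_map raddf_sum; apply: eq_bigr => t _.
by rewrite [RHS]rmorphM.
Qed.

Lemma map_pairs_sub T T' :
  map_pairs p (T ++ opp_pairs T') = map_pairs p T ++ opp_pairs (map_pairs p T').
Proof.
rewrite /map_pairs /opp_pairs map_cat -!map_comp; congr (_ ++ _).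
by apply: eq_map => t /=; rewrite raddfN.
Qed.

End MapPairs.

(** The graph, modulo the image of [H_2 F], of the map
    [R :&: [F, F] -> H_2 G / H_2 F] of Hopf's formula, where [R = ker p]. *)
Definition hopf (F G : lieAlgType) (p : {lie F -> G}) (c : lie_homology G 2) (a : F) :=
  p a = 0 /\
  exists T, [/\ aug_pairs T, ugen a = pairs_mul T & c = lie_theta (map_pairs p T)].

Section Hopf.
Variables (F G : lieAlgType) (p : {lie F -> G}).

Lemma hopf_lcs1 c a : hopf p c a -> a \in lcs_pred F 1.
Proof. by case=> _ [T [aT eT _]]; exact: pairs_mul_lcs1 aT eT. Qed.

Lemma hopf_exists_class a : p a = 0 -> a \in lcs_pred F 1 -> exists c, hopf p c a.
Proof.
move=> pa /lcs1_pairs_mul[T [aT eT]].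
by exists (lie_theta (map_pairs p T)); split=> //; exists T.
Qed.

Lemma pairs_mul_map_ker T a : p a = 0 -> ugen a = pairs_mul T -> pairs_mul (map_pairs p T) = 0.
Proof. by move=> pa eT; rewrite pairs_mul_map -eT umap_gen pa raddf0. Qed.

Lemma hopfB c c' a a' : hopf p c a -> hopf p c' a' -> hopf p (c - c') (a - a').
Proof.
case=> pa [T [aT eT ec]] [pa' [T' [aT' eT' ec']]].
split; first by rewrite raddfB /= pa pa' subrr.
exists (T ++ opp_pairs T'); split.
- exact/aug_pairs_cat/aug_pairs_opp.
- by rewrite raddfB /= eT eT' pairs_mul_cat pairs_mul_opp.
- rewrite map_pairs_sub ec ec'; apply/esym/lie_theta_sub.
  + exact: aug_pairs_map.
  + exact: aug_pairs_map.
  + exact: pairs_mul_map_ker eT.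
  + exact: pairs_mul_map_ker eT'.
Qed.

(** Over [a = 0] the family [T] has product zero already in [ug F], so it defines a class of
    [H_2 F], which maps to [c] by naturality. *)
Lemma hopf0 c : hopf p c 0 -> exists d, lie_homology_map p 2 d = c.
Proof.
case=> _ [T [aT eT ->]]; exists (lie_theta T); apply: lie_theta_map => //.
by rewrite -eT raddf0.
Qed.

Lemma hopfMn n c a : hopf p c a -> hopf p (c *+ n) (a *+ n).
Proof.
move=> ca; have h0 : hopf p 0 0 by rewrite -(subrr c) -(subrr a); exact: hopfB.
elim: n => [//|n IH]; rewrite !mulrS -[c *+ n]opprK -[a *+ n]opprK.
by apply: hopfB => //; rewrite -[- (c *+ n)]sub0r -[- (a *+ n)]sub0r; exact: hopfB.
Qed.

(** Lift a family representing [c] to a family [S] over [F]. Its product lies in the kernel of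
    [umap p], hence is [ugen r] plus the product of a family [D] of [ker_pair]s. Removing [D] from
    [S] leaves the product [ugen r] and does not change the class, since [D] becomes degenerate over
    [G]. *)
Lemma hopf_exists_kernel c :
  (forall y : G, exists x : F, p x = y) -> exists a, hopf p c a.
Proof.
move=> p_surj; have [T [aT mT ->]] := lie_theta_surj c.
have [S eS] : exists S, map_pairs p S = T.
  elim: T {aT mT} => [|[x y] T [S <-]]; first by exists [::].
  have [x' <-] := umap_surj p_surj x; have [y' <-] := umap_surj p_surj y.
  by exists ((x', y') :: S).
have aS : aug_pairs S.
  move=> t tS; rewrite -!(uaug_umap p); apply: (aT (umap p t.1, umap p t.2)).
  by rewrite -eS; exact: (map_f (fun t => (umap p t.1, umap p t.2)) tS).
have [|r [D [pr kD eD]]] := umap_ker p_surj (u := pairs_mul S).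
  by rewrite -pairs_mul_map eS.
have aD : aug_pairs D by move=> t /kD[].
have mD : pairs_mul (map_pairs p D) = 0.
  rewrite pairs_mul_map; have -> : pairs_mul D = pairs_mul S - ugen r by rewrite eD addrC addKr.
  by rewrite raddfB /= -pairs_mul_map eS mT umap_gen pr raddf0 subrr.
exists r; split=> //; exists (S ++ opp_pairs D); split.
- exact/aug_pairs_cat/aug_pairs_opp.
- by rewrite pairs_mul_cat pairs_mul_opp eD addrK.
rewrite map_pairs_sub eS lie_theta_sub //; last exact: aug_pairs_map.
rewrite [X in _ - X]lie_theta_degenerate ?subr0 //; first exact: aug_pairs_map.
by move=> _ /mapP[t /kD[_ _ h] ->].
Qed.

End Hopf.

Lemma hopf_map (F G F' G' : lieAlgType) (p : {lie F -> G}) (p' : {lie F' -> G'})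
    (u : {lie F -> F'}) (v : {lie G -> G'}) c a :
  (forall x, p' (u x) = v (p x)) -> hopf p c a ->
  hopf p' (lie_homology_map v 2 c) (u a).
Proof.
move=> sq [pa [T [aT eT ->]]]; split; first by rewrite sq pa raddf0.
exists (map_pairs u T); split; first exact: aug_pairs_map.
  by rewrite pairs_mul_map -eT umap_gen.
rewrite lie_theta_map; last exact: pairs_mul_map_ker eT; last exact: aug_pairs_map.
congr lie_theta; rewrite /map_pairs -!map_comp; apply: eq_map => t /=.
by rewrite !(umap_square sq).
Qed.

(** * Solving the systems in the cokernel *)

Lemma completion_map_to (F G : lieAlgType) (p : {lie F -> G}) x :
  completion_map p (to_completion x) = to_completion (p x).
Proof. by apply: completionP => n; exact: lcs_map_pi. Qed.

Theorem theoremB (g f : lieAlgType) (r : nat) (b : 'I_r -> f) (p : {lie f -> g})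
    (g_fg : lie_fg g) (f_free : lie_free b)
    (p_surj : forall y : g, exists x : f, p x = y) :
  cotorsion
    (coker
       (copair (lie_homology_map (completion_map p) 2)
               (lie_homology_map (@to_completion g) 2))).
Proof.
apply: cotorsion_system => a.
set cp := copair _ _ in a *.
have hat_surj := completion_map_surj p_surj.
have bF y := lie_free_span y f_free.
pose q := completion_map p.
have [x hx] := choice (fun n => hopf_exists_kernel (repr (a n)) hat_surj).
have qx n : q (x n) = 0 by case: (hx n).
have x1 n : val (x n) 1 = 0 by exact/lcs1_compl/(hopf_lcs1 (hx n)).
(* Level [n.+1] yields vanishing both at level [n], for convergence, and at level [1], even when
   [n = 0]; the latter places [s n] in [[f, f]]. *)
have appr n : exists s, p s = 0 /\ val (x n - to_completion s) n.+1 = 0.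
  by have [s ps xs] := completion_map_ker_dense p_surj n.+1 (qx n); exists s.
have [s hs] := choice appr.
have ps n : p (s n) = 0 by case: (hs n).
have trans0 (z : completion f) n : val z n.+1 = 0 -> val z n = 0.
  by have /asboolP hz := valP z; rewrite -(hz n) => ->; rewrite raddf0.
have xs0 n : val (x n - to_completion (s n)) n = 0.
  by case: (hs n) => _ /trans0.
have xs1 n : val (x n - to_completion (s n)) 1 = 0.
  case: (hs n) => _; elim: n {xs0} (x n - _) => // n IH z /trans0; exact: IH.
have s1 n : s n \in lcs_pred f 1.
  have := xs1 n; rewrite -[LHS]/(val (x n) 1%N - lcs_pi 1 (s n)) x1 sub0r => /eqP.
  by rewrite oppr_eq0 => /eqP/quot_pi_eq0.
have qs n : q (to_completion (s n)) = 0 by rewrite /q completion_map_to ps raddf0.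
have [y [hy [ker_y y1]]] := compl_divisible_system xs0.
have qy n : q (y n) = 0.
  apply: ker_y => k.
  transitivity (q (x k) - q (to_completion (s k))); first exact: raddfB.
  by rewrite qx qs subrr.
(* Finite generation of [f] enters here: vanishing at level [1] gives membership in the algebraic
   commutator of the completion, so that [y n] has a Hopf class. *)
have {}y1 n : y n \in lcs_pred (completion f) 1 by exact: compl_lcs1 bF (y1 1%N xs1 n).
have [c hc] := choice (fun n => hopf_exists_class (qy n) (y1 n)).
have [d hd] := choice (fun n => hopf_exists_class (ps n) (s1 n)).
exists (fun n => \pi_(coker cp) (c n)) => n.
(* The kernel elements attached to this combination add up to
   [y n - y n.+1 *+ n.+1 - (x n - s n) = 0], so it comes from [H_2] of the completion of [f]. *)
have [e he] : exists e, lie_homology_map q 2 e =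
    c n - c n.+1 *+ n.+1 - (repr (a n) - lie_homology_map (@to_completion g) 2 (d n)).
  apply: hopf0; have h1 := hopfB (hc n) (hopfMn n.+1 (hc n.+1)).
  have h2 := hopfB (hx n) (hopf_map (completion_map_to p) (hd n)).
  by have := hopfB h1 h2; rewrite hy subrr.
rewrite -[RHS]reprK -raddfMn -raddfB; apply/eqP.
rewrite -Quotient.idealrBE; apply/asboolP.
exists (e, - d n).
transitivity (lie_homology_map q 2 e + lie_homology_map (@to_completion g) 2 (- d n)).
  by [].
rewrite he [X in _ + X]raddfN opprB -addrA; congr (_ + _).
by rewrite addrAC subrr add0r.
Qed.
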